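(* Let $R\subseteq S$ be quasilocal rings with finitely generated maximal ideals $M$ and $N$, respectively; let $K$ be an $S$-module; let $C$ be a multiplicatively closed subset of nonzerodivisors of $S$, meeting $N$, whose elements are nonzerodivisors on $K$; and suppose that $R$ is twisted by $K$ along $C$. Suppose that $K/NK$ is a finitely generated $S$-module. Then: (1) For nonzero finitely generated ideals $I$ and $J$ of $R$ contracted from $S$ and meeting $C$, where $J$ is $M$-primary, we have for each $n>0$, $$H_{J,I}(n)=H_{JS,IS}(n)+H_{JS,(J+I)K}(n-1).$$ If also $I\subseteq J$, then for each $n\ge 0$, $$H_{J,I}(n)=H_{JS,IS}(n)+H_{JS,K}(n).$$ (2) For each proper nonzero finitely generated ideal $I$ of $R$ contracted from $S$ and meeting $C$, the minimal number of generators of $I$ is $$\mu_R(I)=\mu_S(IS)+\dim_{S/N}K/NK.$$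
   Context: All rings are commutative with identity; a quasilocal ring is a ring with a unique maximal ideal (not necessarily Noetherian). An ideal $I$ of a subring $R\subseteq S$ is contracted from $S$ if $I=IS\cap R$; it meets $C$ if $I\cap C\neq\emptyset$. $\mu_A(I)$ is the minimal number of generators of an ideal $I$ of $A$. Hilbert function: for a quasilocal ring $(A,\mathfrak m)$ with $\mathfrak m$ finitely generated, an $\mathfrak m$-primary ideal $J$, and an $A$-module $L$ (not necessarily finitely generated) with $L/\mathfrak mL$ finitely generated, $H_{J,L}(n)=\operatorname{length}_A(J^nL/J^{n+1}L)$ for $n\ge0$, with $J^0=A$. Here $H_{J,I}$ is computed over $R$, and $H_{JS,IS}$, $H_{JS,K}$, $H_{JS,(J+I)K}$ are computed over $S$. A derivation $D:B\to L$ from a ring $B$ to a $B$-module $L$ is an additive map with $D(st)=sD(t)+tD(s)$; $\ker D$ is its additive kernel. Twisted subring: let $S$ be a ring, $K$ an $S$-module, $C$ a multiplicatively closed subset of nonzerodivisors of $S$ that are also nonzerodivisors on $K$, and view $S\subseteq S_C$, $K\subseteq K_C$ (localizations at $C$). A subring $R$ of $S$ is twisted by $K$ along $C$ if there is a derivation $D:S_C\to K_C$ with $D(c)=0$ for all $c\in C$ such that (a) $R=S\cap D^{-1}(K)$; (b) $D(S_C)$ generates $K_C$ as an $S_C$-module; (c) $S\subseteq \ker D+cS$ for all $c\in C$. In particular $C\subseteq R$. *)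

(* Defs.v *)
From HB Require Import structures.
From mathcomp Require Import all_boot all_order all_algebra.
From mathcomp Require Import boolp classical_sets.
Set Implicit Arguments.
Unset Strict Implicit.
Unset Printing Implicit Defensive.
Import GRing.Theory.
Local Open Scope ring_scope.
Local Open Scope classical_set_scope.

Section Modules.
Variables (A : comNzRingType) (V : lmodType A).
Implicit Types (X Y Z : set V) (J : set A) (n : nat).

Definition submodule X : Prop :=
  X 0 /\ forall a x y, X x -> X y -> X (a *: x + y).

Definition submod_span X : set V := smallest submodule X.

Definition fin_gen X : Prop := exists s : seq V, submod_span [set` s] = X.

(* The product J X of an ideal J and a submodule X. *)
Definition mulsub J X : set V := submod_span [set a *: x | a in J & x in X].

(* [fin_gen_mod m X] : X / m X is finitely generated. *)
Definition fin_gen_mod (m : set A) X : Prop :=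
  exists2 s : seq V, [set` s] `<=` X & submod_span ([set` s] `|` mulsub m X) = X.

(* A strict chain of n + 1 submodules between Z and Y, i.e. of submodules of
   Y / Z when Z is contained in Y. *)
Definition submod_chain Y Z n : Prop :=
  exists f : nat -> set V,
    (forall i, (i <= n)%N -> [/\ submodule (f i), Z `<=` f i & f i `<=` Y])
    /\ (forall i, (i < n)%N -> f i `<` f i.+1).

(* [has_length Y Z n] : Y / Z has finite length n. *)
Definition has_length Y Z n : Prop :=
  submod_chain Y Z n /\ forall k, submod_chain Y Z k -> (k <= n)%N.

(* mu(X) = n *)
Definition min_gens X n : Prop :=
  (exists2 s : seq V, size s = n & submod_span [set` s] = X)
  /\ (forall s : seq V, submod_span [set` s] = X -> (n <= size s)%N).

(* [residue_dim m d] : V / m V has dimension d over A / m (m maximal); the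
   family b lifts a basis. *)
Definition residue_dim (m : set A) (d : nat) : Prop :=
  exists b : 'I_d -> V,
    submod_span (range b `|` mulsub m setT) = setT
    /\ (forall a : 'I_d -> A,
          mulsub m setT (\sum_i a i *: b i) -> forall i, m (a i)).

End Modules.

Section Ideals.
Variable A : comNzRingType.
Implicit Types (I J m : set A) (n : nat).

(* Unlike [idealr_closed], the unit ideal is allowed. *)
Definition ideal I : Prop := submodule (I : set A^o).

Definition ideal_pow J n : set A := iter n (@mulsub A A^o J) setT.

Definition ideal_add I J : set A := [set x + y | x in I & y in J].

Definition maximal_ideal m : Prop :=
  [/\ ideal m, ~ m 1
    & forall I, ideal I -> ~ I 1 -> m `<=` I -> I = m].

Definition quasilocal m : Prop :=
  maximal_ideal m /\ forall m', maximal_ideal m' -> m' = m.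

Definition radical J : set A := [set x | exists n, J (x ^+ n)].

Definition primary_ideal J : Prop :=
  [/\ ideal J, ~ J 1 & forall x y, J (x * y) -> J x \/ radical J y].

Definition primary_to m J : Prop := primary_ideal J /\ radical J = m.

(* [hilbert_function m J X H] : for A quasilocal with maximal ideal m, the
   Hilbert function H_{J,X} is defined and equal to H. *)
Definition hilbert_function (V : lmodType A) m J (X : set V) (H : nat -> nat)
    : Prop :=
  [/\ primary_to m J, fin_gen_mod m X
    & forall n, has_length (mulsub (ideal_pow J n) X)
                           (mulsub (ideal_pow J n.+1) X) (H n)].

End Ideals.

Section Extension.
Variables (S : comNzRingType) (P : {pred S}) (R : subComNzRingType P).

Definition extend (I : set R) : set S :=
  @submod_span S S^o [set val x | x in I].

Definition contracted (I : set R) : Prop := I = val @^-1` extend I.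

Definition meets_mult (I : set R) (C : {pred S}) : Prop :=
  exists2 r, I r & val r \in C.

End Extension.

Section Localization.
Variables (S : comNzRingType) (C : {pred S}).
Variables (SC : comNzRingType) (phi : {rmorphism S -> SC}).

(* SC, with the map phi, is the localization of S at C. *)
Definition ring_localization : Prop :=
  [/\ forall c, c \in C -> exists u, phi c * u = 1,
      forall x, exists s, exists2 c, c \in C & phi c * x = phi s
    & forall s t, phi s = phi t -> exists2 c, c \in C & c * s = c * t].

Variables (K : lmodType S) (KC : lmodType SC).
Variable psi : {linear K -> KC | phi \; *:%R}.

(* KC, with the map psi, is the localization of K at C, when SC is that of S. *)
Definition module_localization : Prop :=
  (forall y, exists k, exists2 c, c \in C & phi c *: y = psi k)
  /\ (forall k l, psi k = psi l -> exists2 c, c \in C & c *: k = c *: l).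

Definition derivation (B : comNzRingType) (L : lmodType B) (D : B -> L) :=
  (forall s t, D (s + t) = D s + D t)
  /\ (forall s t, D (s * t) = s *: D t + t *: D s).

(* The subring P of S is twisted by K along C. *)
Definition twisted (P : {pred S}) : Prop :=
  exists D : SC -> KC,
    [/\ derivation D,
        forall c, c \in C -> D (phi c) = 0,
        forall s, s \in P <-> range psi (D (phi s)),
        submod_span (range D) = setT
      & forall c, c \in C -> forall s,
          exists x, exists2 t, D x = 0 & phi s = x + phi (c * t)].

End Localization.

(* Main.v *)
Require Import Defs.
From HB Require Import structures.
From mathcomp Require Import all_boot all_order all_algebra.
From mathcomp Require Import boolp classical_sets.
From mathcomp Require Import zify ring.
Set Implicit Arguments.
Unset Strict Implicit.
Unset Printing Implicit Defensive.
Import GRing.Theory.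
Local Open Scope ring_scope.
Local Open Scope classical_set_scope.

(** The derivation of the twisting restricts to a map [d : R -> K], and
[r |-> (r, d r)] embeds [R] as a subring of the idealization [S * K], the ring
with [(s, k) (s', k') = (s s', s k' + s' k)].  For every [e] in [C] this
embedding is an isomorphism modulo [e]:
- it is onto modulo [e], because [S = ker d + e S], and because [D(S_C)]
  generates [K_C] ([derivation_approx], [approx_exists]);
- an element of [R] whose image is a multiple of [e] in the idealization is a
  multiple of [e] in [R] ([twist_ker]).

Ideals that meet [C] can therefore be computed in the idealization.  Take an
ideal [a] of [S] and a submodule [L] of [K] that contains [a K].  The ideal
[a + L] of the idealization contracts to [twist_ideal a L], the set of [r] with
[r] in [a] and [d r] in [L].  Contraction is compatible with products
([mulsub_twist_ideal]),
  [(a, L) (b, L') = (a b, a L' + b L)],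
and with lengths ([twist_ideal_length]): the length of [(a1, L1) / (a0, L0)] is
the length of [a1 / a0] plus the length of [L1 / L0].

An ideal [I] of [R] contracted from [S] is [(IS, K)], by definition of
contracted.  Hence [J^n I] is [((JS)^n IS, L_n)], where [L_0 = K] and
[L_(n+1) = JS L_n + (JS)^n IS K].  Solving this recurrence gives
[L_(n+1) = (JS)^n (J + I) K] in general, and [L_n = (JS)^n K] when [I] is
contained in [J]; the two formulas for the Hilbert function are the lengths of
the successive quotients ([hilbert_function_twist]).  Since [M] is [(N, K)], one
also gets [M I = (N IS, N K)] for proper [I], so that the length of [I / M I] is
that of [IS / N IS] plus that of [K / N K].  Over a quasilocal ring Nakayama's
lemma identifies the first two of these lengths with numbers of generators
([min_gens_length]), and the last one is the dimension of [K / N K]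
([residue_dim_length]).

All the lengths that occur are finite: [X / N X] has finite length when it is
finitely generated, hence so has [X / N^k X], and a power of the finitely
generated ideal [N] lies in every ideal whose radical contains [N]. *)

(** * Submodules, sums and products *)

Section Submodules.
Variables (A : comNzRingType) (V : lmodType A).
Implicit Types (X Y Z G : set V) (I J : set A).

Lemma submoduleD X x y : submodule X -> X x -> X y -> X (x + y).
Proof. by case=> _ hX Xx Xy; rewrite -[x]scale1r; apply: hX. Qed.

Lemma submoduleZ X a x : submodule X -> X x -> X (a *: x).
Proof. by case=> X0 hX Xx; rewrite -[_ *: _]addr0; apply: hX. Qed.

Lemma submoduleB X x y : submodule X -> X x -> X y -> X (x - y).
Proof.
by move=> hX Xx Xy; rewrite -scaleN1r; apply: submoduleD => //; exact: submoduleZ.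
Qed.

Lemma submoduleT : submodule [set: V]. Proof. by []. Qed.

Lemma submodule_setI X Y : submodule X -> submodule Y -> submodule (X `&` Y).
Proof.
move=> [X0 hX] [Y0 hY]; split=> // a x y [Xx Yx] [Xy Yy].
by split; [apply: hX | apply: hY].
Qed.

Lemma submodule_span G : submodule (submod_span G).
Proof.
split=> [Y [] [] // | a x y Gx Gy Y [hY GY]].
by case: (hY) => _; apply; [apply: Gx | apply: Gy].
Qed.

Lemma subset_span G : G `<=` submod_span G.
Proof. exact: sub_smallest. Qed.

Lemma span_min G Y : submodule Y -> G `<=` Y -> submod_span G `<=` Y.
Proof. exact: smallest_sub. Qed.

Lemma spanS G Y : G `<=` Y -> submod_span G `<=` submod_span Y.
Proof.
by move=> GY; apply: span_min (submodule_span _) (subset_trans GY (@subset_span _)).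
Qed.

Lemma span_id X : submodule X -> submod_span X = X.
Proof. by move=> hX; apply/seteqP; split; [apply: span_min | apply: subset_span]. Qed.

Definition msum X Y : set V := [set x + y | x in X & y in Y].

Lemma mem_msum X Y x y : X x -> Y y -> msum X Y (x + y).
Proof. by move=> Xx Yy; exists x => //; exists y. Qed.

Lemma submodule_msum X Y : submodule X -> submodule Y -> submodule (msum X Y).
Proof.
move=> hX hY; split=> [|a _ _ [x Xx [y Yy <-]] [x' Xx' [y' Yy' <-]]].
  by rewrite -[0]addr0; apply: mem_msum; [apply: hX.1 | apply: hY.1].
rewrite scalerDr addrACA; apply: mem_msum.
  exact: hX.2.
exact: hY.2.
Qed.

Lemma msum_subl X Y : submodule Y -> X `<=` msum X Y.
Proof. by move=> hY x Xx; rewrite -[x]addr0; apply: mem_msum => //; case: hY. Qed.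

Lemma msum_subr X Y : submodule X -> Y `<=` msum X Y.
Proof. by move=> hX y Yy; rewrite -[y]add0r; apply: mem_msum => //; case: hX. Qed.

Lemma msum_min X Y Z : submodule Z -> X `<=` Z -> Y `<=` Z -> msum X Y `<=` Z.
Proof.
by move=> hZ XZ YZ _ [x /XZ Zx [y /YZ Zy <-]]; apply: submoduleD.
Qed.

Lemma spanU G X : submodule X -> submod_span (G `|` X) = msum (submod_span G) X.
Proof.
move=> hX; have hG := submodule_span G; apply/seteqP; split.
  apply: span_min; first exact: submodule_msum.
  move=> x [Gx | Xx]; last exact: msum_subr.
  by apply: msum_subl => //; apply: subset_span.
apply: msum_min; first exact: submodule_span.
  by apply: spanS; left.
by move=> x Xx; apply: subset_span; right.
Qed.

(** Together with [ideal_colon], this reduces an inclusion between spans or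
products to a check on generators, one factor at a time. *)
Lemma submodule_colon Y a : submodule Y -> submodule [set x | Y (a *: x)].
Proof.
move=> hY; split=> /= [|b x y Yx Yy]; first by rewrite scaler0; case: hY.
by rewrite scalerDr scalerA mulrC -scalerA; apply: hY.2.
Qed.

Lemma ideal_colon Y x : submodule Y -> ideal [set a | Y (a *: x)].
Proof.
move=> hY; split=> /= [|b a a' Ya Ya']; first by rewrite scale0r; case: hY.
by rewrite scalerDl -scalerA; apply: hY.2.
Qed.

Lemma submodule_mulsub J X : submodule (mulsub J X).
Proof. exact: submodule_span. Qed.

Lemma mem_mulsub J X a x : J a -> X x -> mulsub J X (a *: x).
Proof. by move=> Ja Xx; apply: subset_span; exists a => //; exists x. Qed.

Lemma mulsub_min J X Y :
  submodule Y -> (forall a x, J a -> X x -> Y (a *: x)) -> mulsub J X `<=` Y.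
Proof.
move=> hY JXY; apply: span_min => // _ [a Ja [x Xx <-]].
exact: JXY.
Qed.

Lemma mulsubS J J' X X' :
  J `<=` J' -> X `<=` X' -> mulsub J X `<=` mulsub J' X'.
Proof.
move=> JJ XX; apply: mulsub_min; first exact: submodule_mulsub.
by move=> a x Ja Xx; apply: mem_mulsub; [apply: JJ | apply: XX].
Qed.

Lemma mulsub_subr J X : submodule X -> mulsub J X `<=` X.
Proof. by move=> hX; apply: mulsub_min => // a x _; apply: submoduleZ. Qed.

Lemma mulsubT X : submodule X -> mulsub setT X = X.
Proof.
move=> hX; apply/seteqP; split; first exact: mulsub_subr.
by move=> x Xx; rewrite -[x]scale1r; apply: mem_mulsub.
Qed.

Lemma mulsubC I J X : mulsub I (mulsub J X) = mulsub J (mulsub I X).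
Proof.
wlog suff: I J / mulsub I (mulsub J X) `<=` mulsub J (mulsub I X).
  by move=> h; apply/seteqP; split; apply: h.
apply: mulsub_min => [|a x Ia]; first exact: submodule_mulsub.
move: x; apply: mulsub_min => [|b x Jb Xx].
  by apply: submodule_colon; apply: submodule_mulsub.
by rewrite /= scalerA mulrC -scalerA; do 2!apply: mem_mulsub => //.
Qed.

Lemma mulsub_msum J X Y : submodule X -> submodule Y ->
  mulsub J (msum X Y) = msum (mulsub J X) (mulsub J Y).
Proof.
move=> hX hY; have hJX := submodule_mulsub J X; have hJY := submodule_mulsub J Y.
apply/seteqP; split.
  apply: mulsub_min => [|a _ Ja [x Xx [y Yy <-]]]; first exact: submodule_msum.
  by rewrite scalerDr; apply: mem_msum; apply: mem_mulsub.
apply: msum_min; first exact: submodule_mulsub.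
  by apply: mulsubS => //; apply: msum_subl.
by apply: mulsubS => //; apply: msum_subr.
Qed.

End Submodules.

Section IdealProducts.
Variables (A : comNzRingType) (V : lmodType A).
Implicit Types (X Y Z G : set V) (I J : set A).

Lemma mulsubA I J X : mulsub (@mulsub A A^o I J) X = mulsub I (mulsub J X).
Proof.
have hl := submodule_mulsub (@mulsub A A^o I J) X.
have hr := submodule_mulsub I (mulsub J X).
apply/seteqP; split.
  apply: mulsub_min => // c x Ic Xx; move: c Ic.
  apply: (@mulsub_min A A^o _ _ [set c | mulsub I (mulsub J X) (c *: x)]).
    exact: ideal_colon.
  by move=> a b Ia Jb /=; rewrite -scalerA; do 2!apply: mem_mulsub => //.
apply: mulsub_min => // a x Ia; move: x.
apply: mulsub_min; first exact: submodule_colon.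
by move=> b x Jb Xx /=; rewrite scalerA; apply: mem_mulsub => //; apply: mem_mulsub.
Qed.

Lemma mulsub_ideal_add I J X : ideal I -> ideal J ->
  mulsub (ideal_add I J) X = msum (mulsub I X) (mulsub J X).
Proof.
move=> hI hJ; have hIX := submodule_mulsub I X; have hJX := submodule_mulsub J X.
apply/seteqP; split.
  apply: mulsub_min => [|_ x [a Ia [b Jb <-]] Xx]; first exact: submodule_msum.
  by rewrite scalerDl; apply: mem_msum; apply: mem_mulsub.
apply: msum_min; first exact: submodule_mulsub; apply: mulsubS => //.
  exact: (@msum_subl A A^o _ _ hJ).
exact: (@msum_subr A A^o _ _ hI).
Qed.

Lemma mulsub_powS J n X :
  mulsub (ideal_pow J n.+1) X = mulsub J (mulsub (ideal_pow J n) X).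
Proof. exact: mulsubA. Qed.

Lemma fin_gen_submodule X : fin_gen X -> submodule X.
Proof. by case=> s <-; apply: submodule_span. Qed.

Lemma fin_gen_modW m X : fin_gen X -> fin_gen_mod m X.
Proof.
move=> hX; have sX := fin_gen_submodule hX; case: hX => s sE.
have sub : [set` s] `<=` X by rewrite -sE; apply: subset_span.
exists s => //; rewrite spanU; last exact: submodule_mulsub.
rewrite sE; apply/seteqP; split; last exact/msum_subl/submodule_mulsub.
by apply: msum_min => //; apply: mulsub_subr.
Qed.

Lemma fin_gen_mod_submodule m X : fin_gen_mod m X -> submodule X.
Proof. by case=> s _ <-; apply: submodule_span. Qed.

(** Products of generators of [J] with generators of [X] modulo [m X] generate
[J X] modulo [m J X], because [J (m X) = m (J X)]. *)
Lemma fin_gen_mod_mulsub m J X : fin_gen (J : set A^o) ->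
  fin_gen_mod m X -> fin_gen_mod m (mulsub J X).
Proof.
case=> t tE [s sX sE].
have tJ : [set` t] `<=` J by rewrite -tE; apply: (@subset_span A A^o).
pose p := [seq a *: x | a <- t, x <- s].
have pX : [set` p] `<=` mulsub J X.
  by move=> _ /allpairsP[[a x] /= [ta sx ->]]; apply: mem_mulsub; [apply: tJ | apply: sX].
exists p => //; set T := submod_span _.
have hT : submodule T by apply: submodule_span.
apply/seteqP; split.
  apply: span_min; first exact: submodule_mulsub.
  by move=> x [/pX //|]; apply: mulsub_subr; apply: submodule_mulsub.
apply: mulsub_min => // a x Ja Xx; move: a Ja.
rewrite -tE; apply: (@span_min A A^o _ [set a | T (a *: x)]).
  exact: ideal_colon.
move=> a ta /=; move: x Xx; rewrite -{1}sE.
apply: (@span_min _ _ _ [set x | T (a *: x)]); first exact: submodule_colon.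
move=> x [sx | NXx] /=.
  by apply: subset_span; left; apply/allpairsP; exists (a, x).
apply: (@subset_span); right; move: x NXx; apply: mulsub_min.
  exact/submodule_colon/submodule_mulsub.
move=> n x mn Xx /=; rewrite scalerA mulrC -scalerA.
by apply: mem_mulsub => //; apply: mem_mulsub => //; apply: tJ.
Qed.

End IdealProducts.

(** * Chains of submodules and length *)

Section Chains.
Variables (A : comNzRingType) (V : lmodType A).
Implicit Types (X Y Z : set V) (k n p q : nat).

Definition length_le Y Z n := forall k, submod_chain Y Z k -> (k <= n)%N.

Lemma has_length_unique Y Z p q : has_length Y Z p -> has_length Y Z q -> p = q.
Proof.
move=> [cp bp] [cq bq]; apply/eqP; rewrite eqn_leq.
by rewrite bq ?bp.
Qed.

Lemma chain0 Y Z : submodule Y -> Z `<=` Y -> submod_chain Y Z 0.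
Proof. by move=> hY ZY; exists (fun=> Y); split=> // i _; split. Qed.

Lemma chain_sub Y Y' Z Z' n :
  Y `<=` Y' -> Z' `<=` Z -> submod_chain Y Z n -> submod_chain Y' Z' n.
Proof.
move=> YY ZZ [f [hf sf]]; exists f; split=> // i /hf[h1 h2 h3]; split=> //.
  exact: subset_trans h2.
exact: subset_trans YY.
Qed.

Lemma length_leS Y Z Z' n : Z `<=` Z' -> length_le Y Z n -> length_le Y Z' n.
Proof. by move=> ZZ h k /(chain_sub (@subset_refl _ Y) ZZ)/h. Qed.

Lemma chain_rcons Y Y' Z n : submodule Y' -> Y `<` Y' ->
  submod_chain Y Z n -> submod_chain Y' Z n.+1.
Proof.
move=> hY' [YY' nYY'] [f [hf sf]].
have [_ ZY fY] := hf n (leqnn n).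
exists (fun i => if (i <= n)%N then f i else Y'); split=> i hi.
  case: ifP => [/hf[h1 h2 h3] | _]; split=> //.
    exact: subset_trans YY'.
  exact: subset_trans (subset_trans fY YY').
rewrite -ltnS hi; case: ifP => [/sf // | hn].
have -> : i = n by lia.
split; first exact: subset_trans YY'.
by move=> Y'f; apply: nYY'; apply: subset_trans fY.
Qed.

Lemma chain_cat X Y Z p q :
  submod_chain X Y p -> submod_chain Y Z q -> submod_chain X Z (p + q).
Proof.
move=> [f [hf sf]] [g [hg sg]].
have [_ Yf0 f0X] := hf 0%N isT; have [_ Zg gY] := hg q (leqnn q).
exists (fun i => if (i <= q)%N then g i else f (i - q)%N); split=> i hi.
  case: ifP => hq.
    have [h1 h2 h3] := hg i hq; split=> //.
    by apply: subset_trans h3 (subset_trans Yf0 f0X).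
  have [|h1 h2 h3] := hf (i - q)%N; first lia.
  by split=> //; apply: subset_trans Zg _; apply: subset_trans h2.
case: ifP => hq; last first.
  have -> : (i.+1 <= q)%N = false by lia.
  by rewrite subSn; [apply: sf; lia | lia].
case: ifP => hq'; first exact: sg.
have -> : i = q by lia.
rewrite subSnn; have [s1 s2] : f 0%N `<` f 1%N by apply: sf; lia.
split; first by apply: subset_trans s1; apply: subset_trans Yf0.
by move=> fg; apply: s2; apply: subset_trans Yf0; apply: subset_trans gY.
Qed.

Lemma length_exists Y Z n : submodule Y -> Z `<=` Y -> length_le Y Z n ->
  exists m, has_length Y Z m.
Proof.
move=> hY ZY hn; pose P k := `[< submod_chain Y Z k >].
have exP : exists k, P k by exists 0%N; apply/asboolP; apply: chain0.
have ubP k : P k -> (k <= n)%N by move=> /asboolP/hn.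
case: (ex_maxnP exP ubP) => m /asboolP cm hm; exists m; split=> // k ck.
by apply: hm; apply/asboolP.
Qed.

End Chains.

Section ChainMaps.
Variables (A A' A'' : comNzRingType).
Variables (V : lmodType A) (V' : lmodType A') (V'' : lmodType A'').

Lemma chain_map (F : set V -> set V') Y Z Y' Z' n :
  (forall X, submodule X -> Z `<=` X -> X `<=` Y ->
     [/\ submodule (F X), Z' `<=` F X & F X `<=` Y']) ->
  (forall X1 X2, submodule X1 -> Z `<=` X1 -> submodule X2 -> X2 `<=` Y ->
     X1 `<` X2 -> F X1 `<` F X2) ->
  submod_chain Y Z n -> submod_chain Y' Z' n.
Proof.
move=> hF sF [f [hf sf]]; exists (F \o f); split=> i hi /=.
  by have [h1 h2 h3] := hf i hi; apply: hF.
have [h1 h2 h3] := hf i (ltnW hi); have [h4 h5 h6] := hf i.+1 hi.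
by apply: sF => //; apply: sf.
Qed.

(** Subadditivity of length, in the form in which it is used for exact sequences:
when two monotone maps [F] and [G] separate the comparable submodules between
[Z] and [Y], each step of a chain is strict under [F] or under [G], so the
number of steps is at most the sum of the lengths of the two targets. *)
Lemma length_le_split (F : set V -> set V') (G : set V -> set V'')
    Y Z Y' Z' Y'' Z'' p q :
  (forall X, submodule X -> Z `<=` X -> X `<=` Y ->
     [/\ submodule (F X), Z' `<=` F X & F X `<=` Y']) ->
  (forall X, submodule X -> Z `<=` X -> X `<=` Y ->
     [/\ submodule (G X), Z'' `<=` G X & G X `<=` Y'']) ->
  (forall X1 X2, X1 `<=` X2 -> F X1 `<=` F X2 /\ G X1 `<=` G X2) ->
  (forall X1 X2, submodule X1 -> Z `<=` X1 -> submodule X2 -> X2 `<=` Y ->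
     X1 `<=` X2 -> F X2 `<=` F X1 -> G X2 `<=` G X1 -> X2 `<=` X1) ->
  length_le Y' Z' p -> length_le Y'' Z'' q -> length_le Y Z (p + q).
Proof.
move=> hF hG mono sep hp hq k [f [hf sf]].
suff /(_ k (leqnn k))[p' [q' [kpq cp cq]]] : forall j, (j <= k)%N ->
    exists p' q', [/\ (j <= p' + q')%N,
      submod_chain (F (f j)) Z' p' & submod_chain (G (f j)) Z'' q'].
  have [h1 h2 h3] := hf k (leqnn k).
  have [_ _ Fk] := hF _ h1 h2 h3; have [_ _ Gk] := hG _ h1 h2 h3.
  have := hp _ (chain_sub Fk (@subset_refl _ _) cp).
  have := hq _ (chain_sub Gk (@subset_refl _ _) cq).
  lia.
elim=> [|j IH] hj.
  have [h1 h2 h3] := hf 0%N hj.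
  have [F1 F2 _] := hF _ h1 h2 h3; have [G1 G2 _] := hG _ h1 h2 h3.
  by exists 0%N, 0%N; split=> //; apply: chain0.
have [p' [q' [jpq cp cq]]] := IH (ltnW hj).
have [h1 h2 h3] := hf j (ltnW hj); have [h4 h5 h6] := hf _ hj.
have [F1 _ _] := hF _ h4 h5 h6; have [G1 _ _] := hG _ h4 h5 h6.
have [lt1 lt2] := sf j hj; have [mF mG] := mono _ _ lt1.
have cp' := chain_sub mF (@subset_refl _ _) cp.
have cq' := chain_sub mG (@subset_refl _ _) cq.
have [FF | nFF] := pselect (F (f j.+1) `<=` F (f j)); last first.
  by exists p'.+1, q'; split=> //; apply: chain_rcons cp.
have [GG | nGG] := pselect (G (f j.+1) `<=` G (f j)); last first.
  by exists p', q'.+1; split=> //; [lia | apply: chain_rcons cq].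
by case: lt2; apply: sep.
Qed.

End ChainMaps.

Section Additivity.
Variables (A : comNzRingType) (V : lmodType A).
Implicit Types (X Y Z : set V) (p q : nat).

(** The modular law: [W1 <= W2] are equal as soon as they have the same
intersection with [Y] and the same sum with [Y]. *)
Lemma length_le_trans X Y Z p q : submodule X -> submodule Y ->
  Z `<=` Y -> Y `<=` X ->
  length_le Y Z p -> length_le X Y q -> length_le X Z (p + q).
Proof.
move=> hX hY ZY YX; apply: (length_le_split (F := fun W => W `&` Y)
    (G := fun W => msum W Y)).
- move=> W hW ZW _; split; first exact: submodule_setI.
    by move=> z Zz; split; [apply: ZW | apply: ZY].
  by move=> w [].
- move=> W hW _ WX; split; first exact: submodule_msum.
    exact: msum_subr.
  exact: msum_min.
- move=> W1 W2 W12; split; first by move=> w [/W12 ? ?].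
  by move=> _ [w /W12 W2w [y Yy <-]]; apply: mem_msum.
- move=> W1 W2 hW1 _ hW2 _ W12 int sum w W2w.
  have [w1 W1w1 [y Yy def_w]] := sum _ (msum_subl hY W2w).
  have [W1y _] : (W1 `&` Y) y.
    apply: int; split=> //; have -> : y = w - w1 by rewrite -def_w addrC addKr.
    by apply: submoduleB => //; apply: W12.
  by rewrite -def_w; apply: submoduleD.
Qed.

Lemma length_le_id X : length_le X X 0.
Proof.
move=> [//|k] [f [hf sf]]; have [_] := sf 0%N isT; case.
have [_ X0 _] := hf 0%N isT; have [_ _ X1] := hf 1%N isT.
exact: subset_trans X0.
Qed.

End Additivity.

(** * Units and radicals in quasilocal rings *)

Section MaximalIdeals.
Variable A : comNzRingType.
Implicit Types (I J N : set A).

Lemma idealD I x y : ideal I -> I x -> I y -> I (x + y).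
Proof. exact: (@submoduleD A A^o). Qed.

Lemma idealM I a x : ideal I -> I x -> I (a * x).
Proof. exact: (@submoduleZ A A^o). Qed.

(** Zorn's lemma is applied to the sets [X] such that [X `|` I] is a proper ideal,
rather than to the ideals above [I], so that the union of the empty chain
qualifies. *)
Lemma exists_maximal_ideal I : ideal I -> ~ I 1 ->
  exists2 m, maximal_ideal m & I `<=` m.
Proof.
move=> hI I1; pose Q X := ideal (X `|` I) /\ ~ (X `|` I) 1.
have [F FQ Ftot|m [[hm m1] mmax]] := @Zorn_bigcup A Q.
  have cov x : ((\bigcup_(X in F) X) `|` I) x -> I x \/ exists2 X, F X & X x.
    by move=> [[X FX Xx]|]; [right; exists X | left].
  split; last first.
    by move=> /cov[//|[X FX X1]]; case: (FQ X FX) => _; apply; left.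
  split; first by right; case: hI.
  have inX X a x y : F X -> (X `|` I) x -> (X `|` I) y ->
      ((\bigcup_(X in F) X) `|` I) (a *: (x : A^o) + y).
    move=> FX Xx Xy; have [[_ hX] _] := FQ X FX.
    by have [?|?] := hX a x y Xx Xy; [left; exists X | right].
  move=> a x y /cov[Ix|[X FX Xx]] /cov[Iy|[Y FY Yy]].
  - by right; apply: hI.2.
  - by apply: (inX Y) => //; [right | left].
  - by apply: (inX X) => //; [left | right].
  - have [XY|YX] := Ftot X Y FX FY.
      by apply: (inX Y) => //; left=> //; apply: XY.
    by apply: (inX X) => //; left=> //; apply: YX.
exists (m `|` I); last by right.
split=> // J hJ J1 mJ; apply: contrapT => neq.
have IJ : I `<=` J by apply: subset_trans mJ; right.
apply: (mmax J); last by rewrite /Q (setUidl IJ).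
split; first by apply: subset_trans mJ; left.
by move=> Jm; apply: neq; apply/seteqP; split=> // x /Jm; left.
Qed.

Lemma ideal_principal (x : A) : ideal [set a * x | a in [set: A]].
Proof.
split=> [|b _ _ [a _ <-] [a' _ <-]]; first by exists 0; rewrite ?mul0r.
by exists (b * a + a') => //; rewrite mulrDl -mulrA.
Qed.

Lemma quasilocal_unit N x : quasilocal N -> ~ N x -> exists u, u * x = 1.
Proof.
move=> [_ uniqN] Nx; apply: contrapT => nu.
have [|m hm xm] := exists_maximal_ideal (ideal_principal x).
  by move=> [u _ ux]; apply: nu; exists u.
by apply: Nx; rewrite -(uniqN m hm); apply: xm; exists 1; rewrite ?mul1r.
Qed.

Lemma proper_sub_quasilocal N I :
  quasilocal N -> ideal I -> ~ I 1 -> I `<=` N.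
Proof.
move=> hN hI I1 x Ix; apply: contrapT => /(quasilocal_unit hN)[u ux].
by apply: I1; rewrite -ux; apply: idealM.
Qed.

(** In the binomial expansion of [(x + y) ^ (p + q)] every term is divisible by
[x ^ p] or by [y ^ q]. *)
Lemma ideal_radical J : ideal J -> ideal (radical J).
Proof.
move=> hJ; split=> [|a x y [p xp] [q yq]].
  by exists 1%N; rewrite expr1; case: hJ.
exists (p + q)%N; rewrite exprDn; apply: (big_ind J).
- by case: hJ.
- by move=> *; apply: idealD.
move=> i _; rewrite -mulr_natl; apply: idealM => //.
have [qi|iq] := leqP q i.
  by rewrite -(subnK qi) exprD mulrA; apply: idealM.
have -> : (p + q - i = (q - i) + p)%N by lia.
rewrite [a *: _]/(a * x) exprMn (exprD x) mulrC !mulrA.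
exact: idealM.
Qed.

Lemma quasilocal_primary N J :
  quasilocal N -> ideal J -> ~ J 1 -> N `<=` radical J -> primary_to N J.
Proof.
move=> hN hJ J1 NJ; split.
  split=> // x y Jxy; have [/NJ|/(quasilocal_unit hN)[u uy]] := pselect (N y).
    by right.
  by left; rewrite -[x]mulr1 -uy mulrCA; apply: idealM.
apply/seteqP; split=> // x [n Jx]; apply: contrapT.
move=> /(quasilocal_unit hN)[u ux]; apply: J1.
by rewrite -(expr1n _ n) -ux exprMn; apply: idealM.
Qed.

End MaximalIdeals.

(** * Length and generators modulo the maximal ideal *)

Section ResidueLength.
Variables (A : comNzRingType) (V : lmodType A) (N : set A).
Hypothesis hN : quasilocal N.
Implicit Types (X Y Z : set V) (s t : seq V).

Let idealN : ideal N := let: conj (And3 h _ _) _ := hN in h.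

Lemma span_set1 (x : V) : submod_span [set x] = [set a *: x | a in [set: A]].
Proof.
apply/seteqP; split.
  apply: span_min => [|_ ->]; last by exists 1; rewrite ?scale1r.
  split=> [|b _ _ [a _ <-] [a' _ <-]]; first by exists 0; rewrite ?scale0r.
  by exists (b * a + a') => //; rewrite scalerDl scalerA.
move=> _ [a _ <-]; apply: (submoduleZ a (submodule_span _)).
exact: subset_span.
Qed.

(** Any element of a submodule above [Z] that is not in [Z] has the form
[a x + z] with [a] a unit, so the submodule contains [x]: there is nothing
strictly between [Z] and [Z + A x]. *)
Lemma length_le_span1 x Z : submodule Z -> (forall n, N n -> Z (n *: x)) ->
  length_le (msum (submod_span [set x]) Z) Z 1.
Proof.
move=> hZ NxZ [//|[//|k]] [f [hf sf]].
have [h1 Z0 _] := hf 0%N isT; have [h2 Z1 f1] := hf 1%N isT.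
have [_ _ f2] := hf 2%N isT.
have [_ nsub] := sf 0%N isT.
have [w f1w f0w] : exists2 w, f 1%N w & ~ f 0%N w.
  apply: contrapT => nw; apply: nsub => w f1w; apply: contrapT => f0w.
  by apply: nw; exists w.
have [y xy [z Zz def_w]] := f1 _ f1w.
move: xy; rewrite span_set1 => -[a _ def_y].
have Na : ~ N a.
  move=> Na; apply: f0w; rewrite -def_w -def_y.
  by apply: submoduleD => //; apply: Z0 => //; apply: NxZ.
have [u ua] := quasilocal_unit hN Na.
have f1x : f 1%N x.
  rewrite -[x]scale1r -ua -scalerA def_y; apply: submoduleZ => //.
  have -> : y = w - z by rewrite -def_w addrK.
  by apply: submoduleB => //; apply: Z1.
have [_ []] := sf 1%N isT; apply: subset_trans f2 _.
by apply: msum_min => //; apply: span_min => // _ ->.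
Qed.

Lemma length_le_span s Z : submodule Z ->
  (forall n x, N n -> x \in s -> Z (n *: x)) ->
  length_le (submod_span ([set` s] `|` Z)) Z (size s).
Proof.
elim: s Z => [|x s IH] Z hZ NsZ /=.
  suff -> : [set` [::]] `|` Z = Z by rewrite span_id //; apply: length_le_id.
  by apply/seteqP; split=> [y []|y]; [| |right].
pose Z' := msum (submod_span [set x]) Z.
have hZ' : submodule Z' by apply: submodule_msum => //; apply: submodule_span.
have ZZ' : Z `<=` Z' by apply: msum_subr; apply: submodule_span.
have -> : submod_span ([set` x :: s] `|` Z) = submod_span ([set` s] `|` Z').
  have h1 := submodule_span ([set` x :: s] `|` Z).
  have h2 := submodule_span ([set` s] `|` Z').
  apply/seteqP; split; apply: span_min => // y [].
  - rewrite /= in_cons => /orP[/eqP -> | ys]; apply: subset_span; last by left.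
    by right; apply: msum_subl => //; apply: subset_span.
  - by move=> Zy; apply: subset_span; right; apply: ZZ'.
  - by move=> ys; apply: subset_span; left; rewrite /= in_cons ys orbT.
  move: y; apply: msum_min => //.
    by apply: spanS => _ ->; left; rewrite /= mem_head.
  by move=> y Zy; apply: subset_span; right.
rewrite -add1n; apply: (@length_le_trans _ _ _ Z') => //.
- exact: submodule_span.
- by move=> y Z'y; apply: subset_span; right.
- by apply: length_le_span1 => // n Nn; apply: NsZ => //; rewrite mem_head.
apply: IH => // n y Nn ys; apply: ZZ'; apply: NsZ => //.
by rewrite in_cons ys orbT.
Qed.

Lemma minimal_gens_mod X : fin_gen_mod N X ->
  exists s, [/\ [set` s] `<=` X, submod_span ([set` s] `|` mulsub N X) = X &
    forall t, [set` t] `<=` X -> submod_span ([set` t] `|` mulsub N X) = X ->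
      (size s <= size t)%N].
Proof.
move=> [s0 s0X s0E].
pose Q n := `[< exists s, [/\ [set` s] `<=` X,
  submod_span ([set` s] `|` mulsub N X) = X & size s = n] >].
have exQ : exists n, Q n by exists (size s0); apply/asboolP; exists s0.
case: (ex_minnP exQ) => _ /asboolP[s [sX sE <-]] smin.
by exists s; split=> // t tX tE; apply: smin; apply/asboolP; exists t.
Qed.

Section MinimalGens.
Variables (X : set V) (s : seq V).
Hypothesis (sX : [set` s] `<=` X).
Hypothesis (sE : submod_span ([set` s] `|` mulsub N X) = X).
Hypothesis (smin : forall t, [set` t] `<=` X ->
  submod_span ([set` t] `|` mulsub N X) = X -> (size s <= size t)%N).

(** Otherwise the other elements of [s] would still generate [X] modulo [N X],
against the minimality of [s]. *)
Lemma minimal_gens_notin i : (i < size s)%N ->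
  ~ submod_span ([set` take i s ++ drop i.+1 s] `|` mulsub N X) s`_i.
Proof.
move=> hi; set t := _ ++ _ => tsi.
have ts : {subset t <= s}.
  by move=> x; rewrite mem_cat => /orP[/mem_take|/mem_drop].
have tX : [set` t] `<=` X by move=> x /ts/sX.
have : (size s <= size t)%N; last first.
  by rewrite size_cat size_drop size_takel; lia.
apply: smin => //; apply/seteqP; split.
  by rewrite -{2}sE; apply: spanS => x [/ts ?|?]; [left | right].
rewrite -{1}sE; apply: span_min; first exact: submodule_span.
move=> x [|NXx]; last by apply: subset_span; right.
rewrite /= -(cat_take_drop i s) mem_cat (drop_nth 0 hi) in_cons.
move=> /orP[xs|/orP[/eqP -> //|xs]]; apply: subset_span; left;
  by rewrite /= mem_cat xs ?orbT.
Qed.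

(** The length is at most the number of generators by [length_le_span]; adding the
elements of a minimal family one at a time gives a chain with that many
steps. *)
Lemma minimal_gens_length : has_length X (mulsub N X) (size s).
Proof.
have hNX := submodule_mulsub N X.
split; last first.
  rewrite -{1}sE; apply: length_le_span => // n x Nn xs.
  by apply: mem_mulsub => //; apply: sX.
pose Z i := submod_span ([set` take i s] `|` mulsub N X).
suff: submod_chain (Z (size s)) (mulsub N X) (size s).
  by rewrite /Z take_size sE.
have : (size s <= size s)%N by []; move: {1 3 4}(size s); elim=> [|i IH] hi.
  apply: chain0; first exact: submodule_span.
  by move=> x NXx; apply: subset_span; right.
have takeS : {subset take i s <= take i.+1 s}.
  by move=> x xs; rewrite (take_nth 0 hi) mem_rcons in_cons xs orbT.
apply: (@chain_rcons _ _ (Z i)) (IH (ltnW hi)); first exact: submodule_span.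
split; first by apply: spanS => x [/takeS ?|?]; [left | right].
move=> sub; apply: (minimal_gens_notin hi).
have : Z i s`_i.
  apply: sub; apply: subset_span; left.
  by rewrite /= (take_nth 0 hi) mem_rcons mem_head.
by apply: spanS => x [xs|?]; [left; rewrite /= mem_cat xs | right].
Qed.

(** A coefficient outside [N] is a unit, and dividing by it would express one
generator by the others. *)
Lemma minimal_gens_independent (a : 'I_(size s) -> A) :
  mulsub N X (\sum_i a i *: s`_i) -> forall i, N (a i).
Proof.
move=> sumNX i; apply: contrapT => /(quasilocal_unit hN)[u ua].
apply: (minimal_gens_notin (ltn_ord i)); set T := submod_span _.
have hT : submodule T by apply: submodule_span.
have -> : s`_i = u *: (a i *: s`_i) by rewrite scalerA ua scale1r.
apply: (submoduleZ u hT).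
have -> : a i *: s`_i =
    \sum_j a j *: s`_j - \sum_(j | j != i) a j *: s`_j.
  by rewrite (bigD1 i) //= addrK.
apply: (submoduleB hT); first by apply: subset_span; right.
apply: (big_ind T) => [|x y Tx Ty|j ji]; first by case: hT.
  exact: (submoduleD hT).
apply: (submoduleZ _ hT); apply: subset_span; left.
rewrite /= mem_cat; have [lt|gt|/val_inj eq] := ltngtP j i.
- by rewrite -(nth_take 0 lt) mem_nth ?size_takel // ltnW.
- have -> : s`_j = (drop i.+1 s)`_(j - i.+1) by rewrite nth_drop subnKC.
  by rewrite mem_nth ?orbT // size_drop ltn_sub2r // (leq_ltn_trans gt).
by rewrite eq eqxx in ji.
Qed.

End MinimalGens.

Lemma residue_length X : fin_gen_mod N X -> exists n, has_length X (mulsub N X) n.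
Proof.
case/minimal_gens_mod=> s [sX sE smin].
by exists (size s); apply: minimal_gens_length.
Qed.

Lemma residue_dim_length n : fin_gen_mod N [set: V] ->
  has_length [set: V] (mulsub N setT) n -> residue_dim V N n.
Proof.
case/minimal_gens_mod=> s [sX sE smin] hn.
rewrite (has_length_unique hn (minimal_gens_length sX sE smin)).
exists (fun i => s`_i); split.
  suff -> : range (fun i : 'I_(size s) => s`_i) = [set` s] by [].
  apply/seteqP; split=> x /= => [[i _ <-]|/(nthP 0)[i hi <-]].
    by rewrite mem_nth.
  by exists (Ordinal hi).
by move=> a; apply: minimal_gens_independent.
Qed.

(** The classical elimination: modulo [Y], the first generator [x] satisfies
[(1 - n) x] in [N] times the span of the others, with [1 - n] a unit, and so it
can be removed from the relations of the other generators. *)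
Lemma nakayama Y s : submodule Y ->
  (forall x, x \in s -> msum Y (mulsub N (submod_span [set` s])) x) ->
  [set` s] `<=` Y.
Proof.
move=> hY; elim: s => [|x s IH] hs // ; pose W := submod_span [set` s].
have hW : submodule W by apply: submodule_span.
have hNW := submodule_mulsub N W.
have hT := submodule_msum hY hNW.
have split_s : submod_span [set` x :: s] = msum (submod_span [set x]) W.
  rewrite -(spanU _ hW); apply/seteqP; split.
    apply: spanS => y; rewrite /= in_cons => /orP[/eqP ->|ys]; first by left.
    by right; apply: subset_span.
  apply: span_min; first exact: submodule_span.
  move=> y [->|]; first by apply: subset_span; rewrite /= mem_head.
  by apply: spanS => {}y ys; rewrite /= in_cons ys orbT.
(* The span of [x] contributes to the relation of [y] a multiple of [x] by an
   element of [N]. *)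
have dec y : y \in x :: s -> exists2 n, N n & msum Y (mulsub N W) (y - n *: x).
  move=> /hs[z Yz [w]]; rewrite split_s mulsub_msum //; last exact: submodule_span.
  move=> [v Nv [w' NWw' <-]] <-.
  have [n Nn <-] : [set n *: x | n in N] v.
    move: v Nv; apply: mulsub_min.
      split=> [|b _ _ [n Nn <-] [n' Nn' <-]].
        by exists 0; rewrite ?scale0r //; case: idealN.
      exists (b * n + n'); last by rewrite scalerDl scalerA.
      exact: (idealN.2 b n n').
    move=> n y' Nn; rewrite span_set1 => -[b _ <-]; exists (b * n).
      exact: idealM.
    by rewrite scalerA mulrC.
  exists n => //; exists z => //; exists w' => //.
  by rewrite (addrCA z) addrAC subrr add0r.
have Tx : msum Y (mulsub N W) x.
  have [n Nn Tn] := dec x (mem_head _ _).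
  have [|u un] := @quasilocal_unit _ N (1 - n) hN.
    move=> N1; have [[_ + _] _] := hN; apply.
    by rewrite -[1](subrK n); apply: idealD.
  rewrite -[x]scale1r -un -scalerA scalerBl scale1r; exact: submoduleZ.
have sT y : y \in x :: s -> msum Y (mulsub N W) y.
  move=> /dec[n Nn Ty]; rewrite -[y](subrK (n *: x)).
  by apply: submoduleD => //; apply: submoduleZ.
have sY : [set` s] `<=` Y by apply: IH => y ys; apply: sT; rewrite in_cons ys orbT.
move=> y /sT; move: y; apply: (@msum_min _ _ Y) => //.
by apply: (subset_trans (@mulsub_subr _ _ _ _ hW)); apply: span_min.
Qed.

Lemma min_gens_length X n : fin_gen X -> has_length X (mulsub N X) n ->
  min_gens X n.
Proof.
move=> fX hn; have hX := fin_gen_submodule fX.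
have hNX := submodule_mulsub N X.
have [s [sX sE smin]] := minimal_gens_mod (fin_gen_modW N fX).
rewrite (has_length_unique hn (minimal_gens_length sX sE smin)).
split; last first.
  move=> t tE; have tX : [set` t] `<=` X by rewrite -tE; apply: subset_span.
  apply: smin => //; rewrite spanU // tE; apply/seteqP; split.
    by apply: msum_min => //; apply: mulsub_subr.
  exact: msum_subl.
exists s => //; apply/seteqP; split; first exact: span_min.
have [g gE] := fX; rewrite -gE; apply: span_min; first exact: submodule_span.
apply: nakayama; first exact: submodule_span.
move=> x xg; rewrite gE -spanU // sE -gE; exact: subset_span.
Qed.

End ResidueLength.

(** * Existence of Hilbert functions *)

Section HilbertExistence.
Variable A : comNzRingType.
Implicit Types (I J N : set A).

Lemma ideal_ideal_pow J n : ideal (ideal_pow J n).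
Proof. by case: n => [|n]; [apply: submoduleT | apply: submodule_mulsub]. Qed.

Lemma ideal_powD J p q :
  ideal_pow J (p + q) = @mulsub A A^o (ideal_pow J p) (ideal_pow J q).
Proof.
elim: p => [|p IH].
  by rewrite (@mulsubT A A^o) //; apply: ideal_ideal_pow.
by rewrite (@mulsub_powS A A^o) -IH.
Qed.

(** [(J + (x)) (J + (x^i))] is contained in [J + (x^(i+1))]. *)
Lemma pow_sub_adjoin J N x k i : ideal J ->
  ideal_pow N k `<=` @msum A A^o J (submod_span [set (x : A^o)]) ->
  ideal_pow N (k * i) `<=` @msum A A^o J (submod_span [set (x ^+ i : A^o)]).
Proof.
move=> hJ Nk; have hT y := submodule_msum hJ (submodule_span [set (y : A^o)]).
elim: i => [|i IH].
  move=> y _; apply: (msum_subr (V := A^o) hJ); rewrite span_set1.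
  by exists y => //; rewrite expr0 [_ *: _]mulr1.
rewrite mulnS ideal_powD.
apply: (mulsub_min (V := A^o) (hT _)) => a b /Nk + /IH.
rewrite !span_set1 => -[j Jj [_ [c _ <-] <-]] [j' Jj' [_ [c' _ <-] <-]].
exists ((j' + c' * x ^+ i) * j + (c * x) * j').
  by apply: idealD => //; apply: idealM.
exists ((c * c') *: (x ^+ i.+1 : A^o)); first by exists (c * c').
have expand (y : A) : (j' + c' * y) * j + (c * x) * j' + (c * c') * (x * y)
    = (j + c * x) * (j' + c' * y) by ring.
by rewrite exprS; apply: expand.
Qed.

(** The generators of [N] are removed one at a time from the ideal containing a
power of [N]: by [pow_sub_adjoin], if it contains a power of [N] after adjoining
[x], it does so after adjoining [x^e], and [x^e] is in [J] for some [e]. *)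
Lemma pow_sub_radical J N : ideal J -> fin_gen (N : set A^o) ->
  N `<=` radical J -> exists k, ideal_pow N k `<=` J.
Proof.
move=> hJ [s sE] NJ.
have sJ : {in s, forall x, radical J x}.
  by move=> x xs; apply: NJ; rewrite -sE; apply: (@subset_span A A^o).
suff adjoin_seq : forall (t : seq A) J k, ideal J -> {in t, forall x, radical J x} ->
    ideal_pow N k `<=` @submod_span A A^o ([set` t] `|` J) ->
    exists k, ideal_pow N k `<=` J.
  apply: (adjoin_seq s J 1%N hJ sJ).
  rewrite [ideal_pow N _](_ : _ = @mulsub A A^o N setT) // -[in mulsub _ _]sE.
  apply: (mulsub_min (V := A^o) (submodule_span (V := A^o) _)) => a b sa _.
  rewrite [_ *: _]mulrC.
  apply: (idealM b (submodule_span (V := A^o) _)).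
  by move: a sa; apply: (@spanS A A^o) => x xs; left.
move=> {sJ hJ J NJ sE s}; elim=> [|x t IH] J k hJ tJ Nk.
  exists k; apply: subset_trans Nk _; apply: (@span_min A A^o) => // y [] //.
have tJ' y : y \in t -> radical J y by move=> yt; apply: tJ; rewrite in_cons yt orbT.
pose J' := @msum A A^o J (submod_span [set (x : A^o)]).
have hJ' : ideal J' by apply: submodule_msum => //; apply: submodule_span.
have JJ' : J `<=` J' by apply: (@msum_subl A A^o); apply: submodule_span.
have [||k' Nk'] := IH J' k hJ'.
- by move=> y /tJ'[n Jn]; exists n; apply: JJ'.
- apply: subset_trans Nk _; apply: (@span_min A A^o); first exact: submodule_span.
  move=> y [|Jy]; last by apply: (@subset_span A A^o); right; apply: JJ'.
  rewrite /= in_cons => /orP[/eqP -> | yt]; apply: (@subset_span A A^o).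
    by right; apply: (@msum_subr A A^o) => //; apply: (@subset_span A A^o).
  by left.
have [e Jxe] := tJ x (mem_head _ _); exists (k' * e)%N.
apply: subset_trans (pow_sub_adjoin (i := e) hJ Nk') _.
apply: (@msum_min A A^o) => //; apply: (@span_min A A^o) => // _ -> //.
Qed.

Variable N : set A.
Hypothesis (hN : quasilocal N) (fN : fin_gen (N : set A^o)).
Variable V : lmodType A.
Implicit Type X : set V.

Lemma fin_gen_mod_pow J X n : fin_gen (J : set A^o) ->
  fin_gen_mod N X -> fin_gen_mod N (mulsub (ideal_pow J n) X).
Proof.
move=> fJ fX; elim: n => [|n IH].
  by rewrite mulsubT //; apply: fin_gen_mod_submodule fX.
by rewrite mulsub_powS; apply: fin_gen_mod_mulsub.
Qed.

Lemma length_le_pow X k : fin_gen_mod N X ->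
  exists n, length_le X (mulsub (ideal_pow N k) X) n.
Proof.
move=> fX; have hX := fin_gen_mod_submodule fX; elim: k => [|k [n hn]].
  by exists 0%N; rewrite mulsubT //; apply: length_le_id.
have [m [_ hm]] := residue_length hN (fin_gen_mod_pow k fN fX).
exists (m + n)%N; apply: length_le_trans hn => //.
- exact: submodule_mulsub.
- by rewrite mulsub_powS; apply: mulsub_subr; apply: submodule_mulsub.
- exact: mulsub_subr.
by rewrite mulsub_powS.
Qed.

(** [X] has finite length modulo [N^k X] for every [k], and some [N^k] is contained
in [J]. *)
Lemma finite_length_radical J X : ideal J -> N `<=` radical J ->
  fin_gen_mod N X -> forall Z, mulsub J X `<=` Z -> Z `<=` X ->
  exists n, has_length X Z n.
Proof.
move=> hJ NJ fX Z JZ ZX; have hX := fin_gen_mod_submodule fX.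
have [k Nk] := pow_sub_radical hJ fN NJ; have [n hn] := length_le_pow k fX.
apply: (@length_exists _ _ _ _ n) => //; apply: length_leS hn.
by apply: subset_trans JZ; apply: mulsubS.
Qed.

Lemma hilbert_function_exists J X : primary_to N J -> fin_gen (J : set A^o) ->
  fin_gen_mod N X -> exists H, hilbert_function N J X H.
Proof.
move=> pJ fJ fX; have [[hJ _ _] radJ] := pJ.
suff /choice[H hH] : forall n, exists h,
    has_length (mulsub (ideal_pow J n) X) (mulsub (ideal_pow J n.+1) X) h.
  by exists H.
move=> n; apply: (@finite_length_radical J) => //.
- by rewrite radJ.
- exact: fin_gen_mod_pow.
- by rewrite mulsub_powS.
by rewrite mulsub_powS; apply: mulsub_subr; apply: submodule_mulsub.
Qed.

End HilbertExistence.

(** * From the derivation of localizations to a derivation of the subring *)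

Section TwistingDerivation.
Variables (S : comNzRingType) (P : {pred S}) (R : subComNzRingType P).
Variables (K : lmodType S) (C : {pred S}).

(** What the rest of the proof retains of the twisting: the subring is seen from
inside, through the restriction [d] of the derivation, and the localizations no
longer appear.  The last three properties say that, modulo each [c] in [C], the
map [r |-> (r, d r)] from [R] to the idealization of [K] is onto (elements
[(s, 0)], then elements [(0, k)]) and injective. *)
Record twisting (d : R -> K) : Prop := {
  twistD : forall x y, d (x + y) = d x + d y;
  twistM : forall x y, d (x * y) = val x *: d y + val y *: d x;
  twist_const : forall c, c \in C -> exists2 c', val c' = c & d c' = 0;
  twist_split : forall c, c \in C ->
    forall s, exists a t, d a = 0 /\ s = val a + c * t;
  twist_surj : forall c, c \in C ->
    forall k, exists r t k', val r = c * t /\ k = d r + c *: k';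
  twist_ker : forall c, c \in C ->
    forall (r : R) t k, val r = c * t -> d r = c *: k -> exists r' : R, val r' = t }.

Hypothesis hC : mulr_closed C.
Hypothesis hCS : forall c, c \in C -> GRing.lreg c.
Hypothesis hCK : forall c, c \in C -> injective (fun k : K => c *: k).
Variables (SC : comNzRingType) (phi : {rmorphism S -> SC}).
Hypothesis hSC : ring_localization C phi.
Variables (KC : lmodType SC) (psi : {linear K -> KC | phi \; *:%R}).
Hypothesis hKC : module_localization C psi.

Let psiZ s k : psi (s *: k) = phi s *: psi k.
Proof. by rewrite linearZ. Qed.

Let psiD k l : psi (k + l) = psi k + psi l.
Proof. by rewrite (raddfD psi). Qed.

Lemma localization_cancel c x y :
  c \in C -> phi c *: x = phi c *: y -> x = y :> KC.
Proof.
have [inv _ _] := hSC => /inv[u cu] eq_c.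
by rewrite -[x]scale1r -[y]scale1r -cu mulrC -!scalerA eq_c.
Qed.

Section Derivation.
Variable D : SC -> KC.
Hypothesis hD : derivation D.
Hypothesis DC : forall c, c \in C -> D (phi c) = 0.

Lemma derivation0 : D 0 = 0.
Proof. by apply: (addIr (D 0)); rewrite -hD.1 !add0r. Qed.

Lemma derivation_const c x : c \in C -> D (phi c * x) = phi c *: D x.
Proof. by move=> cC; rewrite hD.2 DC // scaler0 addr0. Qed.

Hypothesis span_D : submod_span (range D) = setT.
Hypothesis split_S : forall c, c \in C -> forall s,
  exists x, exists2 t, D x = 0 & phi s = x + phi (c * t).

(** Up to a denominator [b] independent of [c], the element [y] is a value of [D]
on [S], modulo [c K].  Values of [D] are nearly exact, and so all of [K_C] is,
because nearly exact elements form a submodule. *)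
Definition nearly_exact : set KC := [set y | exists2 b, b \in C &
  forall c, c \in C -> exists v k, phi b *: y = D (phi v) + phi c *: psi k].

(** The point is the closure under scaling.  A multiple [s (D v)] is not a value of
[D], but writing [s = x0 + c e t] with [D x0 = 0] and [e] a denominator of
[D v], it differs from [D (x0 v)] by the element [c t (e (D v))] of [c K].
Here [e] depends on [v], hence on [c], which is why [s] cannot be split in
advance. *)
Lemma submodule_nearly_exact : submodule nearly_exact.
Proof.
have [C1 CM] := hC; split=> [|a x y [b bC bx] [b' b'C by']].
  exists 1 => // c cC; exists 0, 0.
  by rewrite rmorph0 (raddf0 psi) derivation0 !scaler0 addr0.
have [_ frac _] := hSC; have [s [c0 c0C c0a]] := frac a.
exists (c0 * b * b') => [|c cC]; first by do 2!apply: hC.2 => //.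
have [v [k xE]] := bx c cC; have [v' [k' yE]] := by' c cC.
have [[kv [e eC evE]] _] := (hKC.1 (D (phi v)), hKC.2).
have [x0 [t Dx0 sE]] := split_S (CM _ _ cC eC) (s * b').
have [w wE] : exists w, phi w = x0 * phi v.
  exists ((s * b' - c * e * t) * v); rewrite rmorphM rmorphB sE.
  by rewrite addrK.
exists (w + c0 * b * v'), (t *: kv + (s * b') *: k + (c0 * b) *: k').
have -> : phi (c0 * b * b') *: (a *: x + y) =
    phi (s * b') *: (phi b *: x) + phi (c0 * b) *: (phi b' *: y).
  rewrite !rmorphM -c0a scalerDr !scalerA; congr (_ *: _ + _ *: _); ring.
have -> : phi (w + c0 * b * v') = x0 * phi v + phi (c0 * b) * phi v'.
  by rewrite rmorphD wE (rmorphM _ (c0 * b)).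
have -> : D (x0 * phi v + phi (c0 * b) * phi v') =
    x0 *: D (phi v) + phi (c0 * b) *: D (phi v').
  by rewrite hD.1 hD.2 Dx0 scaler0 addr0 derivation_const //; apply: hC.2.
have swap x1 x2 (z : KC) : x1 *: (x2 *: z) = x2 *: (x1 *: z).
  by rewrite !scalerA mulrC.
have cetE : phi (c * e * t) *: D (phi v) = phi c *: (phi t *: (phi e *: D (phi v))).
  by rewrite !scalerA -!rmorphM; congr (phi _ *: _); ring.
rewrite xE yE !scalerDr {1}sE scalerDl !psiD !psiZ -evE !scalerDr cetE.
rewrite [phi (s * b') *: (phi c *: _)]swap [phi (c0 * b) *: (phi c *: _)]swap.
rewrite -!addrA; congr (_ + _); rewrite [RHS]addrCA; congr (_ + _).
by rewrite addrCA.
Qed.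

Lemma all_nearly_exact y : nearly_exact y.
Proof.
have : [set: KC] y by []; rewrite -span_D; move: y.
apply: span_min => [|_ [x _ <-]]; first exact: submodule_nearly_exact.
have [_ frac _] := hSC; have [s [b bC bx]] := frac x.
exists b => // c cC; exists s, 0.
by rewrite (raddf0 psi) scaler0 addr0 -derivation_const // bx.
Qed.

(** Near exactness for the modulus [b c], where [b] is the denominator of [k],
gives [b k = D v + b c k'].  Splitting [v = x + b t] with [D x = 0] makes
[D v = b (D t)], and [b] cancels. *)
Lemma derivation_approx c k : c \in C ->
  exists v k', psi k = D (phi v) + phi c *: psi k'.
Proof.
move=> cC; have [b bC] := all_nearly_exact (psi k).
have bcC : b * c \in C by apply: hC.2.
case/(_ _ bcC)=> v [k' bkE]; have [x [t Dx vE]] := split_S bC v.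
exists t, k'; apply: (localization_cancel bC).
rewrite bkE vE hD.1 Dx add0r rmorphM derivation_const // scalerDr.
by rewrite rmorphM scalerA.
Qed.

End Derivation.

(** For surjectivity, the element [v] of [derivation_approx] satisfies
[D v = k - c k'], which is in [K], and so [v] is in [R]; subtracting from it an
element of [ker d] makes it a multiple of [c]. *)
Lemma twisted_twisting : twisted C psi P -> exists d : R -> K, twisting d.
Proof.
have [C1 CM] := hC; move=> [D [hD DC inP span_D split_S]].
have psi_inj : injective psi.
  by move=> k l /hKC.2[c cC]; apply: hCK.
have phi_inj : injective phi.
  by have [_ _ eqP] := hSC => s t /eqP[c cC]; apply: hCS.
have [d dE] : exists d : R -> K, forall r, psi (d r) = D (phi (val r)).
  suff /choice[d dE] : forall r : R, exists k, psi k = D (phi (val r)) by exists d.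
  by move=> r; have /inP[k _ kE] := valP r; exists k.
have inR s k : psi k = D (phi s) -> exists2 r : R, val r = s & d r = k.
  move=> kE; have sP : s \in P by apply/inP; exists k.
  exists (Sub s sP); first by rewrite SubK.
  by apply: psi_inj; rewrite dE SubK kE.
have dsplit c : c \in C -> forall s, exists a t, d a = 0 /\ s = val a + c * t.
  move=> cC s; have [x [t Dx sE]] := split_S c cC s.
  have xE : x = phi (s - c * t) by rewrite rmorphB sE addrK.
  have [a aE da] : exists2 a : R, val a = s - c * t & d a = 0.
    by apply: inR; rewrite (raddf0 psi) -xE.
  by exists a, t; rewrite aE subrK.
have dD x y : d (x + y) = d x + d y.
  by apply: psi_inj; rewrite psiD !dE !rmorphD hD.1.
exists d; split=> //.
- move=> x y; apply: psi_inj.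
  by rewrite psiD !psiZ !dE !rmorphM hD.2.
- by move=> c cC; apply: inR; rewrite (raddf0 psi) DC.
- move=> c cC k.
  have [v [k' kE]] := derivation_approx hD DC span_D split_S k cC.
  have [r0 r0E dr0] : exists2 r : R, val r = v & d r = k - c *: k'.
    by apply: inR; rewrite (raddfB psi) /= psiZ kE addrK.
  have [a [t [da vE]]] := dsplit c cC v.
  exists (r0 - a), t, k'; split; first by rewrite rmorphB /= r0E vE addrC addKr.
  have <- : d r0 = d (r0 - a) by rewrite -[in LHS](subrK a r0) (dD (r0 - a)) da addr0.
  by rewrite dr0 subrK.
- move=> c cC r t k rE drE.
  have [r' r'E _] : exists2 r' : R, val r' = t & d r' = k.
    apply: inR; apply: (localization_cancel cC).
    by rewrite -psiZ -drE dE rE rmorphM derivation_const.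
  by exists r'.
Qed.

End TwistingDerivation.

(** * Ideals of the subring coming from the idealization *)

Section TwistIdeals.
Variables (S : comNzRingType) (P : {pred S}) (R : subComNzRingType P).
Variables (K : lmodType S) (C : {pred S}) (d : R -> K).
Hypothesis hC : mulr_closed C.
Hypothesis hd : twisting C d.
Implicit Types (a b : set S) (L : set K) (Z I J : set R).

Lemma twist0 : d 0 = 0.
Proof. by apply: (addIr (d 0)); rewrite -(twistD hd) !add0r. Qed.

Lemma twistB x y : d (x - y) = d x - d y.
Proof. by rewrite -[in RHS](subrK y x) (twistD hd (x - y)) addrK. Qed.

Lemma twistZ x y : d x = 0 -> d (x * y) = val x *: d y.
Proof. by move=> dx; rewrite (twistM hd) dx scaler0 addr0. Qed.

(** [(s, k)] is congruent to the image [(r, d r)] of [r] modulo [e] in the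
idealization of [K]. *)
Definition approx e (r : R) s k := exists t k', s = val r + e * t /\ k = d r + e *: k'.

Lemma approx_exists e s k : e \in C -> exists r, approx e r s k.
Proof.
move=> eC; have [x [t [dx sE]]] := twist_split hd eC s.
have [r [t' [k' [rE kE]]]] := twist_surj hd eC k.
exists (x + r), (t - t'), k'; split; last by rewrite (twistD hd) dx add0r.
by rewrite sE rmorphD /= rE mulrBr; ring.
Qed.

Lemma approxD e r s k r' s' k' :
  approx e r s k -> approx e r' s' k' -> approx e (r + r') (s + s') (k + k').
Proof.
move=> [t [l [-> ->]]] [t' [l' [-> ->]]]; exists (t + t'), (l + l').
rewrite rmorphD (twistD hd) /= scalerDr mulrDr.
by split; rewrite addrACA.
Qed.

(** The product is that of the idealization; the map [r |-> (r, d r)] is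
multiplicative since [d] is a derivation. *)
Lemma approxM e r s k r' s' k' :
  approx e r s k -> approx e r' s' k' ->
  approx e (r * r') (s * s') (s *: k' + s' *: k).
Proof.
move=> [t [l [-> ->]]] [t' [l' [-> ->]]].
exists (val r * t' + t * val r' + e * t * t').
exists (val r *: l' + t *: d r' + (e * t) *: l' +
        (val r' *: l + t' *: d r + (e * t') *: l)).
rewrite rmorphM (twistM hd) /=; split; first by ring.
have expand u v y z : (u + e * v) *: (y + e *: z) =
    u *: y + e *: (u *: z + v *: y + (e * v) *: z) :> K.
  rewrite scalerDl !scalerDr !scalerA -!addrA mulrC [e * v * e]mulrC.
  by rewrite mulrA.
by rewrite !expand addrACA -scalerDr.
Qed.

(** If [x] and [r] have images congruent modulo [e], then [x - r] is a multiple of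
[e] in [R], by [twist_ker]. *)
Lemma approx_mem Z e r s k x : ideal Z -> e \in C ->
  (exists2 z, Z z & val z = e) -> Z r -> approx e r s k ->
  val x = s -> d x = k -> Z x.
Proof.
move=> hZ eC [z Zz zE] Zr [t [k' [sE kE]]] xs xk.
have vB : val (x - r) = e * t by rewrite rmorphB /= xs sE addrC addKr.
have [|y yE] := twist_ker hd eC vB (k := k').
  by rewrite twistB xk kE addrC addKr.
rewrite -[x](subrK r); apply: idealD => //.
have -> : x - r = y * z by apply: val_inj; rewrite rmorphM /= vB yE zE mulrC.
exact: idealM.
Qed.

(** The contraction to [R] of the subset [a + L] of the idealization of [K]. *)
Definition twist_ideal a L : set R := [set r | a (val r) /\ L (d r)].

(** The last condition makes [a + L] an ideal of the idealization.  The element [e],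
meant to be in [C], then makes it contain all multiples of [e], since
[e K <= L]. *)
Definition twist_pair e a L : Prop :=
  [/\ ideal a, submodule L, a e & forall s k, a s -> L (s *: k)].

Lemma ideal_twist_ideal e a L : twist_pair e a L -> ideal (twist_ideal a L).
Proof.
move=> [ha hL ae aL]; split=> [|x y z [ay Ly] [az Lz]].
  by split; rewrite /= ?rmorph0 ?twist0; [case: ha | case: hL].
split; first by rewrite /= rmorphD rmorphM; apply: idealD => //; apply: idealM.
rewrite /= (twistD hd) (twistM hd); do 2!apply: submoduleD => //.
  exact: submoduleZ.
exact: aL.
Qed.

Lemma twist_ideal_const e a L :
  e \in C -> twist_pair e a L -> exists2 z, twist_ideal a L z & val z = e.
Proof.
move=> eC [ha hL ae aL]; have [z zE dz] := twist_const hd eC.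
by exists z => //; split; rewrite ?zE ?dz; [|case: hL].
Qed.

Lemma approx_in e a L r s k : twist_pair e a L -> a s -> L k ->
  approx e r s k -> twist_ideal a L r.
Proof.
move=> [ha hL ae aL] + + [t [k' [sE kE]]]; rewrite sE kE => hs hk; split.
  have -> : val r = val r + e * t - t * e by ring.
  by apply: (submoduleB (V := S^o)) => //; apply: idealM.
rewrite -[d r](addrK (e *: k')); apply: submoduleB => //.
exact: aL.
Qed.

Lemma in_approx e a L r s k : twist_pair e a L -> twist_ideal a L r ->
  approx e r s k -> a s /\ L k.
Proof.
move=> [ha hL ae aL] [ar Lr] [t [k' [-> ->]]]; split.
  by apply: idealD => //; rewrite mulrC; apply: idealM.
by apply: submoduleD => //; apply: aL.
Qed.

Lemma twist_idealS e a L a' L' : e \in C ->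
  twist_pair e a L -> twist_pair e a' L' ->
  twist_ideal a L `<=` twist_ideal a' L' -> a `<=` a' /\ L `<=` L'.
Proof.
move=> eC h h' sub; split=> [s hs|k hk].
  have [r hr] := approx_exists s 0 eC.
  have L0 : L 0 by case: h => _ [].
  by have [] := in_approx h' (sub _ (approx_in h hs L0 hr)) hr.
have [r hr] := approx_exists 0 k eC.
have a0 : a 0 by case: h => -[].
by have [] := in_approx h' (sub _ (approx_in h a0 hk hr)) hr.
Qed.

Lemma twist_pairM e a L e' b L' : twist_pair e a L -> twist_pair e' b L' ->
  twist_pair (e * e') (@mulsub S S^o a b) (msum (mulsub a L') (mulsub b L)).
Proof.
move=> [ha hL ae aL] [hb hL' be' bL']; have hab := submodule_mulsub a (b : set S^o).
have haL := submodule_mulsub a L'; have hbL := submodule_mulsub b L.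
have hsum := submodule_msum haL hbL.
split=> //; first exact: (@mem_mulsub S S^o).
move=> s k; move: s.
apply: (@mulsub_min S S^o _ _ _ (ideal_colon k hsum)) => x y ax bY.
rewrite /= -scalerA; apply: msum_subl => //.
by apply: mem_mulsub => //; apply: bL'.
Qed.

(** The product [Z] contains the element [f = e e'] of [C], so it suffices to find
every pair [(s, k)] of the right-hand side among the images of [Z] modulo [f].
These pairs are closed under sums and under scaling by [S = ker d + f S], and
contain [(x y, 0)], [(0, x k')] and [(0, y k)] for [x], [k] in [a], [L] and
[y], [k'] in [b], [L'], as products of lifts modulo [f]. *)
Lemma mulsub_twist_ideal e a L e' b L' : e \in C -> e' \in C ->
  twist_pair e a L -> twist_pair e' b L' ->
  @mulsub R R^o (twist_ideal a L) (twist_ideal b L') =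
  twist_ideal (@mulsub S S^o a b) (msum (mulsub a L') (mulsub b L)).
Proof.
move=> eC e'C h h'; have hM := twist_pairM h h'; have iM := ideal_twist_ideal hM.
have [ha hL ae aL] := h; have [hb hL' be' bL'] := h'.
have haL := submodule_mulsub a L'; have hbL := submodule_mulsub b L.
set Z := mulsub _ _; set f := e * e' in hM.
have hZ : ideal Z by apply: submodule_mulsub.
have fC : f \in C by apply: hC.2.
have Zf : exists2 z, Z z & val z = f.
  have [z hz zE] := twist_ideal_const eC h.
  have [z' hz' z'E] := twist_ideal_const e'C h'.
  exists (z * z'); first exact: (@mem_mulsub R R^o).
  by rewrite rmorphM /= zE z'E.
have pf : twist_pair f a L.
  by split=> //; rewrite /f mulrC; apply: idealM.
have pf' : twist_pair f b L' by split=> //; apply: idealM.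
apply/seteqP; split.
  apply: (@mulsub_min R R^o) => // x y [ax Lx] [bY Ly]; split.
    by rewrite /= rmorphM; apply: (@mem_mulsub S S^o).
  by rewrite /= (twistM hd); apply: mem_msum; apply: mem_mulsub.
(* [U s k]: the pair is congruent modulo [f] to the image of an element of [Z]. *)
pose U s k := exists2 z, Z z & approx f z s k.
have UD s k s' k' : U s k -> U s' k' -> U (s + s') (k + k').
  move=> [z Zz hz] [z' Zz' hz']; exists (z + z'); first exact: (idealD hZ).
  exact: approxD.
have UZ s s' k' : U s' k' -> U (s * s') (s *: k').
  move=> [z Zz hz]; have [x hx] := approx_exists s 0 fC.
  exists (x * z); first exact: (idealM _ hZ).
  by have := approxM hx hz; rewrite scaler0 addr0.
have UM s k s' k' : a s -> L k -> b s' -> L' k' -> U (s * s') (s *: k' + s' *: k).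
  move=> as_ Lk bs' Lk'; have [x hx] := approx_exists s k fC.
  have [y hy] := approx_exists s' k' fC; exists (x * y); last exact: approxM.
  apply: (@mem_mulsub R R^o); first exact: approx_in hx.
  exact: approx_in hy.
have a0 : a 0 by case: ha. have b0 : b 0 by case: hb.
have L0 : L 0 by case: hL. have L'0 : L' 0 by case: hL'.
have U00 : U 0 0 by have := UM _ _ _ _ a0 L0 b0 L'0; rewrite mul0r !scale0r addr0.
have hU1 : submodule ([set s | U s 0] : set S^o).
  split=> // c s s' Us Us' /=; rewrite -[0](addr0 (0 : K)); apply: UD => //.
  by rewrite -[0](scaler0 K c); apply: UZ.
have hU2 : submodule [set k | U 0 k].
  split=> // c k k' Uk Uk' /=; rewrite -[0](addr0 (0 : S)); apply: UD => //.
  by rewrite -[0](mulr0 c); apply: UZ.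
move=> r [abr Lr]; suff [z Zz hz] : U (val r) (d r) by apply: approx_mem hz _ _.
rewrite -[val r]addr0 -[d r]add0r; apply: UD.
  move: (val r) abr; apply: (@mulsub_min S S^o _ _ _ hU1) => s s' as_ bs'.
  by have := UM _ _ _ _ as_ L0 bs' L'0; rewrite !scaler0 addr0.
move: (d r) Lr; apply: (msum_min hU2); apply: (mulsub_min hU2).
  move=> s k as_ L'k.
  by have := UM _ _ _ _ as_ L0 b0 L'k; rewrite mulr0 scale0r addr0.
move=> s k bs Lk.
by have := UM _ _ _ _ a0 Lk bs L'0; rewrite mul0r scale0r add0r.
Qed.

(** For the lower bound, enlarge first [L0] to [L1] and then [a0] to [a1]; strict
inclusions remain strict by [twist_idealS].  For the upper bound, an ideal [Z]
between the two is determined by its image in [a1] (the ideal [Z + e S]) and by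
the trace in [L1 / L0] of its elements lying over [a0]; both are submodules
over [S], and not only over [R], because [S = ker d + e S]. *)
Lemma twist_ideal_length e a0 a1 L0 L1 p q : e \in C ->
  twist_pair e a0 L0 -> twist_pair e a1 L1 -> a0 `<=` a1 -> L0 `<=` L1 ->
  @has_length S S^o a1 a0 p -> has_length L1 L0 q ->
  @has_length R R^o (twist_ideal a1 L1) (twist_ideal a0 L0) (p + q).
Proof.
move=> eC h0 h1 a01 L01 [ca ba] [cL bL].
have [ha0 hL0 a0e aL0] := h0; have [ha1 hL1 a1e aL1] := h1.
have pa a : ideal a -> a0 `<=` a -> a `<=` a1 -> twist_pair e a L1.
  move=> ha a0a aa1; split=> //; first exact: a0a.
  by move=> s k /aa1; apply: aL1.
have pL L : submodule L -> L0 `<=` L -> twist_pair e a0 L.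
  by move=> hL LL; split=> // s k /aL0-/(_ k)/LL.
split.
  apply: (@chain_cat R R^o _ (twist_ideal a0 L1)).
    apply: (@chain_map S R S^o R^o (fun a => twist_ideal a L1) _ _ _ _ _ _ _ ca).
      move=> a ha a0a aa1; split; first exact: ideal_twist_ideal (pa _ ha a0a aa1).
        by move=> r [/a0a].
      by move=> r [/aa1].
    move=> a a' ha a0a ha' aa1 [aa' naa']; split; first by move=> r [/aa'].
    have h := pa a ha a0a (subset_trans aa' aa1).
    have h' := pa a' ha' (subset_trans a0a aa') aa1.
    by move=> /(twist_idealS eC h' h)[].
  apply: (@chain_map S R K R^o (fun L => twist_ideal a0 L) _ _ _ _ _ _ _ cL).
    move=> L hL L0L LL1; split; first exact: ideal_twist_ideal (pL _ hL L0L).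
      by move=> r [? /L0L].
    by move=> r [? /LL1].
  move=> L L' hL L0L hL' LL1 [LL' nLL']; split; first by move=> r [? /LL'].
  have h := pL L hL L0L; have h' := pL L' hL' (subset_trans L0L LL').
  by move=> /(twist_idealS eC h' h)[].
have e_split := twist_split hd eC.
apply: (@length_le_split _ _ _ R^o S^o K
  (fun Z => [set s | exists2 z, Z z & exists t, s = val z + e * t])
  (fun Z => [set k | exists z, [/\ Z z, a0 (val z) & L0 (k - d z)]])
  _ _ a1 a0 L1 L0) => //.
- move=> Z hZ Z0 Z1; split.
  + split.
      by exists 0; [case: hZ | exists 0; rewrite rmorph0 mulr0 addr0].
    move=> s _ _ [z Zz [t ->]] [z' Zz' [t' ->]].
    have [x [u [_ ->]]] := e_split s.
    exists (x * z + z'); first exact: hZ.2.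
    exists (val x * t + u * val z + u * (e * t) + t').
    have expand (x1 z1 z2 : S) : (x1 + e * u) * (z1 + e * t) + (z2 + e * t') =
        x1 * z1 + z2 + e * (x1 * t + u * z1 + u * (e * t) + t') by ring.
    by rewrite rmorphD rmorphM; apply: expand.
  + move=> s a0s; have [r hr] := approx_exists s 0 eC.
    have [t [_ [sE _]]] := hr; exists r; last by exists t.
    by apply: Z0; apply: approx_in hr => //; case: hL0.
  + move=> _ [z /Z1[az _] [t ->]]; apply: idealD => //.
    by rewrite mulrC; apply: idealM.
- move=> Z hZ Z0 Z1; split.
  + split.
      by exists 0; rewrite rmorph0 twist0 subr0; split; [case: hZ|case: ha0|case: hL0].
    move=> s k k' [z [Zz az Lz]] [z' [Zz' az' Lz']].
    have [x [u [dx ->]]] := e_split s.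
    exists (x * z + z'); split; first exact: hZ.2.
      by rewrite rmorphD rmorphM; apply: idealD => //; apply: idealM.
    rewrite (twistD hd) (twistZ _ dx).
    have -> : (val x + e * u) *: k + k' - (val x *: d z + d z') =
        val x *: (k - d z) + (k' - d z') + e *: (u *: k).
      rewrite scalerDl scalerA scalerBr opprD addrACA -!addrA; congr (_ + _).
      by rewrite addrC -!addrA; congr (_ + _); rewrite addrC -!addrA.
    by apply: submoduleD => //; [apply: hL0.2 | apply: aL0].
  + move=> k L0k; have [r hr] := approx_exists 0 k eC.
    have a00 : a0 0 by case: ha0.
    have rin := approx_in h0 a00 L0k hr; exists r; split; first exact: Z0.
      by case: rin.
    by apply: submoduleB => //; case: rin.
  + move=> k [z [/Z1[_ Lz] _ Lkz]]; rewrite -[k](subrK (d z)).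
    by apply: submoduleD => //; apply: L01.
- move=> Z Z' ZZ'; split=> [s [z /ZZ' Zz zE]|k [z [/ZZ' Zz az Lz]]].
    by exists z.
  by exists z.
move=> Z Z' hZ Z0 hZ' Z1 ZZ' FF GG z' Z'z'.
have [|z Zz [t tE]] := FF (val z');
  first by exists z' => //; exists 0; rewrite mulr0 addr0.
have Z'B : Z' (z' - z) by apply: (submoduleB (V := R^o)) => //; apply: ZZ'.
have aB : a0 (val (z' - z)).
  by rewrite rmorphB /= tE addrC addKr mulrC; apply: idealM.
have [|y [Zy ay Ly]] := GG (d (z' - z)).
  by exists (z' - z); rewrite subrr; split=> //; case: hL0.
have : Z (z' - z - y).
  apply: Z0; split; last by rewrite /= twistB.
  by rewrite /= rmorphB; apply: (submoduleB (V := S^o)).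
move=> ZB; have -> : z' = (z' - z - y) + (z + y) by ring.
exact: (idealD hZ ZB (idealD hZ Zz Zy)).
Qed.

End TwistIdeals.

(** * Extended ideals *)

Section Extension.
Variables (S : comNzRingType) (P : {pred S}) (R : subComNzRingType P).
Implicit Types I J : set R.

Lemma ideal_extend I : ideal (extend I).
Proof. exact: (@submodule_span S S^o). Qed.

Lemma mem_extend I x : I x -> extend I (val x).
Proof. by move=> Ix; apply: (@subset_span S S^o); exists x. Qed.

Lemma extend_min I (a : set S) :
  ideal a -> (forall x, I x -> a (val x)) -> extend I `<=` a.
Proof. by move=> ha Ia; apply: (@span_min S S^o) => // _ [x Ix <-]; apply: Ia. Qed.

Lemma ideal_preim (a : set S) : ideal a -> ideal [set x : R | a (val x)].
Proof.
move=> ha; split=> [|x y z ay az]; first by rewrite /= rmorph0; case: ha.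
by rewrite /= rmorphD rmorphM; apply: idealD => //; apply: idealM.
Qed.

Lemma fin_gen_extend I : fin_gen (I : set R^o) -> fin_gen (extend I : set S^o).
Proof.
move=> [s sE]; exists (map val s : seq S).
have hs := @submodule_span S S^o [set` (map val s : seq S)].
apply/seteqP; split.
  apply: (@span_min S S^o); first exact: ideal_extend.
  move=> _ /mapP[x xs ->]; apply: mem_extend.
  by rewrite -sE; apply: (@subset_span R R^o).
apply: extend_min => // x; rewrite -sE; move: x.
apply: (@span_min R R^o _ _ (ideal_preim hs)) => x xs.
by apply: (@subset_span S S^o); apply: map_f.
Qed.

Lemma extend_add I J : ideal I -> ideal J ->
  extend (ideal_add I J) = ideal_add (extend I) (extend J).
Proof.
move=> hI hJ; have hi := ideal_extend I; have hj := ideal_extend J.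
apply/seteqP; split.
  apply: extend_min; first exact: (@submodule_msum S S^o).
  move=> _ [x Ix [y Jy <-]]; rewrite rmorphD.
  by apply: (@mem_msum S S^o); apply: mem_extend.
apply: (@msum_min S S^o); first exact: ideal_extend.
  apply: extend_min => [|x Ix]; first exact: ideal_extend.
  by apply: mem_extend; apply: (@msum_subl R R^o).
apply: extend_min => [|x Jx]; first exact: ideal_extend.
by apply: mem_extend; apply: (@msum_subr R R^o).
Qed.

Lemma contracted_proper I : contracted I -> ~ I 1 -> ~ extend I 1.
Proof. by move=> cI I1 ?; apply: I1; rewrite cI /= rmorph1. Qed.

End Extension.

(** * Twisted subrings of quasilocal rings *)

Section TwistedLocal.
Variables (S : comNzRingType) (P : {pred S}) (R : subComNzRingType P).
Variables (M : set R) (N : set S).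
Hypothesis hR : quasilocal M.
Hypothesis hS : quasilocal N.
Hypothesis hN : fin_gen (N : set S^o).
Variables (K : lmodType S) (C : {pred S}).
Hypothesis hC : mulr_closed C.
Hypothesis hCN : exists2 c, c \in C & N c.
Hypothesis hK : fin_gen_mod N [set: K].
Variable d : R -> K.
Hypothesis hd : twisting C d.
Implicit Types I J : set R.

Let idealN : ideal N := let: conj (And3 h _ _) _ := hS in h.

(** [S / N = R / (N `&` R)] because [S = R + c S] for some [c] in [C] and [N], so
that [N `&` R] is maximal. *)
Lemma contracted_maximal : M = [set x | N (val x)].
Proof.
have [_ uniqM] := hR; apply/esym/uniqM; have hM := ideal_preim R idealN.
split=> // [|I hI I1 NI].
  by rewrite /= rmorph1; case: hS => -[].
apply/seteqP; split=> // x Ix; apply: contrapT.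
move=> /(quasilocal_unit hS)[u ux]; have [c cC Nc] := hCN.
have [y [t [_ uE]]] := twist_split hd cC u; apply: I1.
rewrite -[1](subrK (y * x)); apply: idealD => //; last exact: idealM.
apply: NI; rewrite /= rmorphB rmorphM rmorph1 /=.
have -> : 1 - val y * val x = t * val x * c by rewrite -ux uE; ring.
exact: idealM.
Qed.

Lemma twist_pairT I (c : R) : I c -> twist_pair (val c) (extend I) [set: K].
Proof. by move=> Ic; split=> //; [apply: ideal_extend | apply: mem_extend]. Qed.

Lemma contracted_twist_ideal I :
  contracted I -> I = twist_ideal d (extend I) setT.
Proof. by move=> cI; rewrite [LHS]cI; apply/seteqP; split=> x // []. Qed.

(** Every element of [N] is [y + c t] with [c] in [C] and [N], and [y] in [R],
hence [y] and [c] in [M], the radical of [J]. *)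
Lemma primary_extend J : contracted J -> primary_to M J -> primary_to N (extend J).
Proof.
move=> cJ [[hJ J1 _] radJ]; have hE := ideal_extend J.
apply: quasilocal_primary => //; first exact: contracted_proper.
have rad (y : R) : N (val y) -> radical (extend J) (val y).
  move=> Ny; have [n Jn] : radical J y by rewrite radJ contracted_maximal.
  by exists n; rewrite -rmorphXn; apply: mem_extend.
have hrad := ideal_radical hE.
move=> x Nx; have [c cC Nc] := hCN; have [y [t [_ xE]]] := twist_split hd cC x.
have [z zE _] := twist_const hd cC.
rewrite xE; apply: (idealD hrad); last first.
  by rewrite mulrC; apply: (idealM _ hrad); rewrite -zE; apply: rad; rewrite zE.
apply: rad; have -> : val y = x - t * c by rewrite xE mulrC addrK.
by apply: (submoduleB (V := S^o) idealN) => //; apply: idealM.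
Qed.

Section Powers.
Variables (I J : set R).
Hypothesis (cI : contracted I) (cJ : contracted J).
Hypothesis (mI : meets_mult I C) (mJ : meets_mult J C).
Local Notation a := (extend J).
Local Notation b := (extend I).
Variable L : nat -> set K.
Hypothesis L0 : L 0%N = setT.
Hypothesis LS : forall n, L n.+1 =
  msum (mulsub a (L n)) (mulsub (@mulsub S S^o (ideal_pow a n) b) setT).

(** [LS] is the second component of the product [(JS, K) ((JS)^n IS, L_n)]. *)
Lemma pow_twist_ideal n :
  @mulsub R R^o (ideal_pow J n) I =
    twist_ideal d (@mulsub S S^o (ideal_pow a n) b) (L n)
  /\ exists2 e, e \in C & twist_pair e (@mulsub S S^o (ideal_pow a n) b) (L n).
Proof.
have [c Jc cC] := mJ; have [c' Ic' c'C] := mI.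
have hJ := twist_pairT Jc; have hI := twist_pairT Ic'.
have iI : ideal I.
  rewrite (contracted_twist_ideal cI); exact: (ideal_twist_ideal hd hI).
elim: n => [|n [IHE [e eC he]]].
  rewrite (@mulsubT R R^o) // (@mulsubT S S^o); last exact: ideal_extend.
  by rewrite L0; split; [apply: contracted_twist_ideal | exists (val c')].
rewrite (@mulsub_powS R R^o) (@mulsub_powS S S^o) IHE LS.
rewrite {1}(contracted_twist_ideal cJ) (mulsub_twist_ideal hC hd cC eC hJ he).
split=> //; exists (val c * e); first exact: hC.2.
exact: twist_pairM.
Qed.

Lemma pow_length n p q :
  has_length (mulsub (ideal_pow a n) (b : set S^o))
    (mulsub (ideal_pow a n.+1) (b : set S^o)) p ->
  has_length (L n) (L n.+1) q ->
  has_length (mulsub (ideal_pow J n) (I : set R^o))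
    (mulsub (ideal_pow J n.+1) (I : set R^o)) (p + q).
Proof.
move=> hp hq; have [-> [e eC he]] := pow_twist_ideal n.
have [-> [e' e'C he']] := pow_twist_ideal n.+1.
have sub_a : mulsub (ideal_pow a n.+1) (b : set S^o) `<=`
    mulsub (ideal_pow a n) (b : set S^o).
  rewrite (@mulsub_powS S S^o); apply: (@mulsub_subr S S^o).
  exact: (@submodule_mulsub S S^o).
have [ha hL _ aL] := he; have [_ _ ae' _] := he'.
have sub_L : L n.+1 `<=` L n.
  rewrite LS; apply: msum_min => //; first exact: mulsub_subr.
  by apply: mulsub_min => // s k /aL.
apply: (twist_ideal_length hd e'C he' _ sub_a sub_L hp hq).
by split=> //; apply: sub_a.
Qed.

End Powers.

Section HilbertFunctions.
Variables (I J : set R).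
Hypothesis (hI : ideal I) (fI : fin_gen (I : set R^o)).
Hypothesis (cI : contracted I) (mI : meets_mult I C).
Hypothesis (hJ : ideal J) (fJ : fin_gen (J : set R^o)).
Hypothesis (cJ : contracted J) (mJ : meets_mult J C).
Hypothesis pJ : primary_to M J.
Local Notation a := (extend J).
Local Notation b := (extend I).
Local Notation IJK := (mulsub (extend (ideal_add J I)) [set: K]).

Let hilbert_exists (V : lmodType S) (X : set V) :
  fin_gen_mod N X -> exists H, hilbert_function N a X H.
Proof.
move=> fX; apply: hilbert_function_exists => //; first exact: primary_extend.
exact: fin_gen_extend.
Qed.

Let fin_gen_IJ : fin_gen (ideal_add J I : set R^o).
Proof.
have [s sE] := fJ; have [t tE] := fI; exists (s ++ t).
have hIJ : ideal (ideal_add J I) by apply: (@submodule_msum R R^o).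
have hst := @submodule_span R R^o [set` s ++ t].
apply/seteqP; split.
  apply: (@span_min R R^o) => // x; rewrite /= mem_cat => /orP[xs|xt].
    by apply: (@msum_subl R R^o) => //; rewrite -sE; apply: (@subset_span R R^o).
  by apply: (@msum_subr R R^o) => //; rewrite -tE; apply: (@subset_span R R^o).
apply: (@msum_min R R^o) => //.
  by rewrite -[X in X `<=` _]sE; apply: (@spanS R R^o) => x xs; rewrite /= mem_cat xs.
rewrite -[X in X `<=` _]tE; apply: (@spanS R R^o) => x xs.
by rewrite /= mem_cat xs orbT.
Qed.

Lemma length_mod_IJK : exists q, has_length [set: K] IJK q.
Proof.
have [[ha _ _] rada] := primary_extend cJ pJ.
apply: (@finite_length_radical _ _ hS hN _ a) => //; first by rewrite rada.
by rewrite extend_add // mulsub_ideal_add; try exact: ideal_extend;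
  apply: msum_subl; apply: submodule_mulsub.
Qed.

(** The function [H] is read off from the solution [L_(n+1) = (JS)^n (J + I) K] of
the recurrence.  When [I <= J], the other solution [L_n = (JS)^n K] computes the
same lengths. *)
Lemma hilbert_function_twist : exists HI HIS : nat -> nat,
  [/\ hilbert_function M J (I : set R^o) HI,
      hilbert_function N a (b : set S^o) HIS,
      exists2 HJIK : nat -> nat, hilbert_function N a IJK HJIK
        & forall n, (0 < n)%N -> HI n = (HIS n + HJIK n.-1)%N
    & I `<=` J -> exists2 HK : nat -> nat, hilbert_function N a [set: K] HK
        & forall n, HI n = (HIS n + HK n)%N].
Proof.
have hIJK := submodule_mulsub (extend (ideal_add J I)) [set: K].
have [HIS hHIS] := hilbert_exists (fin_gen_modW N (fin_gen_extend fI)).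
have [HJIK hHJIK] := hilbert_exists
  (fin_gen_mod_mulsub (fin_gen_extend fin_gen_IJ) hK).
have [q0 hq0] := length_mod_IJK.
have [_ _ lIS] := hHIS; have [_ _ lJIK] := hHJIK.
have IJKE : IJK = msum (mulsub a setT) (mulsub b setT).
  by rewrite extend_add // mulsub_ideal_add //; apply: ideal_extend.
pose L n := if n is m.+1 then mulsub (ideal_pow a m) IJK else setT.
pose H n := (HIS n + if n is m.+1 then HJIK m else q0)%N.
(* The recurrence holds since [(JS)^n IS K] is contained in [(JS)^n (J + I) K]. *)
have lenI n : has_length (mulsub (ideal_pow J n) (I : set R^o))
    (mulsub (ideal_pow J n.+1) (I : set R^o)) (H n).
  apply: (pow_length cI cJ mI mJ (L := L)) => //; last first.
    by case: n => [|n] //=; rewrite mulsubT.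
  case=> [|m]; rewrite /L.
    rewrite [LHS](mulsubT hIJK) IJKE (@mulsubT S S^o) //.
    exact: ideal_extend.
  rewrite mulsub_powS mulsubA; apply/seteqP; split.
    by apply: msum_subl; apply: submodule_mulsub.
  apply: msum_min => //; first exact: submodule_mulsub.
  rewrite -mulsub_powS; apply: mulsubS => //; rewrite IJKE.
  by apply: msum_subr; apply: submodule_mulsub.
exists H, HIS; split=> //.
- by split=> //; apply: fin_gen_modW.
- by exists HJIK => // -[].
move=> IJ; have [HK hHK] := hilbert_exists hK; have [_ _ lK] := hHK.
exists HK => // n; apply: has_length_unique (lenI n) _.
apply: (pow_length cI cJ mI mJ (L := fun n => mulsub (ideal_pow a n) setT)) => //.
  exact: mulsubT (@submoduleT _ _).
move=> m; rewrite mulsub_powS mulsubA; apply/seteqP; split.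
  by apply: msum_subl; apply: submodule_mulsub.
apply: msum_min => //; first exact: submodule_mulsub.
rewrite mulsubC; apply: mulsubS => //.
apply: extend_min => [|x /IJ]; first exact: ideal_extend.
exact: mem_extend.
Qed.

End HilbertFunctions.

(** [I / M I] is the quotient of [(IS, K)] by [(N, K) (IS, K) = (N IS, N K)]. *)
Lemma min_gens_twist I : ~ I 1 -> fin_gen (I : set R^o) -> contracted I ->
  meets_mult I C -> exists mR mS n : nat,
    [/\ min_gens (I : set R^o) mR, min_gens (extend I : set S^o) mS,
        residue_dim K N n & mR = (mS + n)%N].
Proof.
move=> I1 fI cI [c Ic cC]; set b := extend I; have hb : ideal b := ideal_extend I.
have fb : fin_gen (b : set S^o) := fin_gen_extend fI.
have bN : b `<=` N by apply: proper_sub_quasilocal => //; apply: contracted_proper.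
have [c0 c0C Nc0] := hCN.
have [p hp] := residue_length hS (fin_gen_modW N fb).
have [q hq] := residue_length hS hK.
exists (p + q)%N, p, q; split=> //.
2: exact: (min_gens_length hS).
2: exact: (residue_dim_length hS).
apply: (min_gens_length hR) => //.
have pN : twist_pair c0 N [set: K] by split.
have pI : twist_pair (val c) b [set: K] := twist_pairT Ic.
have ME : M = twist_ideal d N setT.
  by rewrite contracted_maximal; apply/seteqP; split=> x // [].
have prodE : @mulsub R R^o M I =
    twist_ideal d (@mulsub S S^o N b) (mulsub N setT).
  rewrite ME [I in mulsub _ I](contracted_twist_ideal cI).
  rewrite (mulsub_twist_ideal hC hd c0C cC pN pI); congr (twist_ideal _ _ _).
  apply/seteqP; split; last by apply: msum_subl; apply: submodule_mulsub.
  by apply: msum_min; [apply: submodule_mulsub| |apply: mulsubS].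
rewrite prodE [I in has_length I](contracted_twist_ideal cI).
have eC : c0 * val c \in C by apply: hC.2.
have hM : twist_pair (c0 * val c) (@mulsub S S^o N b) (mulsub N [set: K]).
  split; [exact: (@submodule_mulsub S S^o) | exact: submodule_mulsub | |].
    by apply: (@mem_mulsub S S^o) => //; apply: mem_extend.
  move=> s k hs; apply: mem_mulsub => //.
  by apply: bN; apply: (@mulsub_subr S S^o) hs.
have hb' : twist_pair (c0 * val c) b [set: K].
  by split=> //; apply: (idealM c0 hb); apply: mem_extend.
apply: (twist_ideal_length hd eC hM hb') => //.
exact: (@mulsub_subr S S^o).
Qed.

End TwistedLocal.

(** * Hilbert functions and numbers of generators *)

Theorem theorem4p2
  (S : comNzRingType) (P : {pred S}) (R : subComNzRingType P)
  (M : set R) (N : set S)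
  (hR : quasilocal M) (hM : fin_gen (M : set R^o))
  (hS : quasilocal N) (hN : fin_gen (N : set S^o))
  (K : lmodType S) (C : {pred S})
  (hC : mulr_closed C)
  (hCS : forall c, c \in C -> GRing.lreg c)
  (hCN : exists2 c, c \in C & N c)
  (hCK : forall c, c \in C -> injective (fun k : K => c *: k))
  (SC : comNzRingType) (phi : {rmorphism S -> SC})
  (hSC : ring_localization C phi)
  (KC : lmodType SC) (psi : {linear K -> KC | phi \; *:%R})
  (hKC : module_localization C psi)
  (htw : twisted C psi P)
  (hK : fin_gen_mod N [set: K]) :
  (forall I J : set R,
     ideal I -> I <> [set 0] -> fin_gen (I : set R^o) ->
     contracted I -> meets_mult I C ->
     ideal J -> J <> [set 0] -> fin_gen (J : set R^o) ->
     contracted J -> meets_mult J C ->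
     primary_to M J ->
     exists HI HIS : nat -> nat,
       [/\ hilbert_function M J (I : set R^o) HI,
           hilbert_function N (extend J) (extend I : set S^o) HIS,
           exists2 HJIK : nat -> nat,
             hilbert_function N (extend J)
               (mulsub (extend (ideal_add J I)) [set: K]) HJIK
             & forall n : nat, (0 < n)%N ->
                 HI n = (HIS n + HJIK n.-1)%N
         & I `<=` J ->
           exists2 HK : nat -> nat,
             hilbert_function N (extend J) [set: K] HK
             & forall n : nat, HI n = (HIS n + HK n)%N])
  /\
  (forall I : set R,
     ideal I -> ~ I 1 -> I <> [set 0] -> fin_gen (I : set R^o) ->
     contracted I -> meets_mult I C ->
     exists mR mS d : nat,
       [/\ min_gens (I : set R^o) mR,
           min_gens (extend I : set S^o) mS,
           residue_dim K N d
         & mR = (mS + d)%N]).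
Proof.
have [d hd] := twisted_twisting R hC hCS hCK hSC hKC htw.
split.
  move=> I J hI _ fI cI mI hJ _ fJ cJ mJ pJ.
  exact: (hilbert_function_twist hR hS hN hC hCN hK hd).
move=> I _ I1 _ fI cI mI.
exact: (min_gens_twist hR hS hC hCN hK hd).
Qed.
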